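(* Consider the closed-loop system, defined on $\{(w,p)\in\mathbb{R}^n\times\mathbb{R}^2 : w_1\neq 0\}$, $$\begin{bmatrix}\dot w\\ \dot p\end{bmatrix}=\begin{bmatrix}0_n & Q_w\\ -Q_w^\top & C_w-D_d\end{bmatrix}\begin{bmatrix}\nabla_w\mathcal{H}_d\\ \nabla_p\mathcal{H}_d\end{bmatrix},\qquad \mathcal{H}_d(w,p)=\tfrac12 p^\top M_w^{-1}(w)p+\tfrac12 w^\top L w,$$ where $D_d=D_w+\hat D+\frac{k}{w_1^2}Q_w^\top e_1e_1^\top Q_w$, $\hat D\in\mathbb{R}^{2\times2}$ is positive definite, $k>0$ is a constant, $L=\operatorname{diag}(l_1,\dots,l_n)$ is constant with all $l_i>0$, $e_1\in\mathbb{R}^n$ is the first standard basis vector, and $Q_w,C_w,D_w,M_w$ are as in the context. If the initial conditions satisfy $w_1(t_0)\neq 0$, then $\lim_{t\to\infty}w_1(t)=0$. Furthermore, this implies that $z(t)=f_w^{-1}(w(t))$ satisfies $\lim_{t\to\infty}z(t)=0_{n\times 1}$.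
   Context: Setting. Let $n\ge 3$; all given functions below are smooth. A mechanical system has configuration $q\in\mathbb{R}^n$, canonical momentum $p_0\in\mathbb{R}^n$, mass matrix $M_0(q)=M_0^\top(q)>0$, potential energy $\mathcal{V}(q)>0$, damping matrix $D_0(p_0,q)=D_0^\top(p_0,q)\ge0$, input matrix $G_0(q)\in\mathbb{R}^{n\times2}$ and is subject to the non-integrable constraints $G_c^\top(q)\dot q=0$ with $G_c(q)\in\mathbb{R}^{n\times(n-2)}$ of full rank, where $[G_0(q)\ G_c(q)]$ is invertible. Let $Q(q)\in\mathbb{R}^{n\times 2}$ have rank 2 with $Q^\top G_c=0$. With reduced momentum $p=Q^\top p_0\in\mathbb{R}^2$ put $P(q,p)=M_0Q(Q^\top M_0Q)^{-1}p$ and $M=Q^\top M_0Q$, $D(q,p)=Q^\top D_0(P(q,p),q)Q$, $G=Q^\top G_0$, $C(q,p)=Q^\top\{(\frac{\partial P}{\partial q})^\top-\frac{\partial P}{\partial q}\}Q$ (Jacobian in $q$ at fixed $p$). The coordinates $z$. Assume there is a coordinate transformation (diffeomorphism) $z=f_z(q)$ of $\mathbb{R}^n$ with $f_z^{-1}(0_{n\times1})=0_{n\times 1}$ such that $Q_z(z)=\left[\frac{\partial f_z}{\partial q}Q\right]_{q=f_z^{-1}(z)}$ is smooth and the system has a chained structure, i.e. $Q_z$ has the left annihilator ($Q_z^\perp Q_z=0$) $$Q_z^\perp(z)=\begin{bmatrix}-z_2&0&1&0&\cdots&0\\-z_3&0&0&1&\cdots&0\\ \vdots&\vdots&\vdots&\vdots&\ddots&\vdots\\-z_{n-1}&0&0&0&\cdots&1\end{bmatrix}\in\mathbb{R}^{(n-2)\times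 n}.$$ Let $M_z,C_z,D_z$ denote $M,C,D$ evaluated at $q=f_z^{-1}(z)$. The coordinates $w$. Define the smooth map $f_w^{-1}:w\mapsto z$ by $z_1=w_1$, $z_2=w_1w_2+\sum_{i=3}^n\frac{1}{(i-2)!}w_1^{i-2}w_i$, and $z_j=\sum_{i=3}^n\frac{1}{(i+j-4)!}w_1^{i+j-4}w_i$ for $3\le j\le n$. Restricted to $w_1\ne0$ it is a bijection onto $\{z_1\neq0\}$, with inverse $f_w$. For $w_1\neq 0$ set $Q_w(w)=\left[\frac{\partial f_w}{\partial z}Q_z\right]_{z=f_w^{-1}(w)}$, and let $M_w,C_w,D_w$ denote $M_z,C_z,D_z$ evaluated at $z=f_w^{-1}(w)$. $\nabla$ denotes the column gradient. *)

(* Defs.v *)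
(* MathComp-Analysis; R : realType.  Vectors are columns and the configuration
   dimension n >= 3 is written m.+3, so that there are n - 2 = m.+1 constraints. *)
From HB Require Import structures.
From mathcomp Require Import all_boot all_order all_algebra.
From mathcomp Require Import all_classical all_reals all_analysis.

Set Implicit Arguments.
Unset Strict Implicit.
Unset Printing Implicit Defensive.

Import Order.TTheory GRing.Theory Num.Theory.
Import numFieldNormedType.Exports.

Local Open Scope classical_set_scope.
Local Open Scope ring_scope.

Section Calculus.
Context {R : realType}.

Fixpoint Ck {V W : normedModType R} (k : nat) (f : V -> W) : Prop :=
  if k is k'.+1 then
    (forall x, differentiable f x) /\ (forall v, Ck k' (fun x => 'D_v f x))
  else continuous f.

Definition smooth {V W : normedModType R} (f : V -> W) : Prop :=
  forall k, Ck k f.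

(* The library's [jacobian] acts on row vectors and is the transpose of the
   Jacobian matrix; this is the usual one, (jac f x) i j = d f_i / d x_j. *)
Definition jac {a b : nat} (f : 'cV[R]_a -> 'cV[R]_b) (x : 'cV[R]_a) :
  'M[R]_(b, a) := \matrix_(i, j) ('D_(delta_mx j 0) f x) i 0.

Definition grad {a : nat} (h : 'cV[R]_a -> R) (x : 'cV[R]_a) : 'cV[R]_a :=
  \col_j 'D_(delta_mx j 0) (h : 'cV[R]_a -> R^o) x.

Definition symmetric_mx {a : nat} (A : 'M[R]_a) : Prop := A^T = A.

Definition posdef {a : nat} (A : 'M[R]_a) : Prop :=
  forall x : 'cV[R]_a, x != 0 -> 0 < (x^T *m A *m x) 0 0.

Definition possemidef {a : nat} (A : 'M[R]_a) : Prop :=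
  forall x : 'cV[R]_a, 0 <= (x^T *m A *m x) 0 0.

(* 1-based coordinates: co x i is x_i, meaningful for 1 <= i <= a.+1. *)
Definition co {a : nat} (x : 'cV[R]_a.+1) (i : nat) : R := x (inord i.-1) 0.

End Calculus.

Section System.
Context {R : realType} {m : nat}.

(* Gc^T(q) q' = 0 is integrable when it is the velocity form of a regular
   configuration constraint h(q) = const. *)
Definition integrable_constraint (Gc : 'cV[R]_m.+3 -> 'M[R]_(m.+3, m.+1)) :=
  exists h : 'cV[R]_m.+3 -> 'cV[R]_m.+1,
    smooth h /\
    forall q, \rank (jac h q) = m.+1 /\
      forall v : 'cV[R]_m.+3, (Gc q)^T *m v = 0 <-> jac h q *m v = 0.

Record mechanical_system := MechanicalSystem {
  M0 : 'cV[R]_m.+3 -> 'M[R]_m.+3;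
  potential : 'cV[R]_m.+3 -> R;
  D0 : 'cV[R]_m.+3 -> 'cV[R]_m.+3 -> 'M[R]_m.+3;  (* D0 p0 q *)
  G0 : 'cV[R]_m.+3 -> 'M[R]_(m.+3, 2);
  Gc : 'cV[R]_m.+3 -> 'M[R]_(m.+3, m.+1);
  Q : 'cV[R]_m.+3 -> 'M[R]_(m.+3, 2);
  M0_smooth : smooth M0;
  potential_smooth : smooth (potential : 'cV[R]_m.+3 -> R^o);
  D0_smooth : smooth (fun x : 'cV[R]_m.+3 * 'cV[R]_m.+3 => D0 x.1 x.2);
  G0_smooth : smooth G0;
  Gc_smooth : smooth Gc;
  Q_smooth : smooth Q;
  M0_sym : forall q, symmetric_mx (M0 q);
  M0_pos : forall q, posdef (M0 q);
  potential_pos : forall q, 0 < potential q;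
  D0_sym : forall p0 q, symmetric_mx (D0 p0 q);
  D0_ge0 : forall p0 q, possemidef (D0 p0 q);
  Gc_rank : forall q, \rank (Gc q) = m.+1;
  Gc_nonintegrable : ~ integrable_constraint Gc;
  G0Gc_unit : forall q, (row_mx (G0 q) (Gc q) : 'M[R]_m.+3) \in unitmx;
  Q_rank : forall q, \rank (Q q) = 2;
  Q_Gc : forall q, (Q q)^T *m Gc q = 0
}.

Implicit Types S : mechanical_system.

Definition Mq S q : 'M[R]_2 := (Q S q)^T *m M0 S q *m Q S q.

Definition Pq S q (p : 'cV[R]_2) : 'cV[R]_m.+3 :=
  M0 S q *m Q S q *m invmx (Mq S q) *m p.

Definition Dq S q (p : 'cV[R]_2) : 'M[R]_2 :=
  (Q S q)^T *m D0 S (Pq S q p) q *m Q S q.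

Definition Cq S q (p : 'cV[R]_2) : 'M[R]_2 :=
  let J := jac (fun q' => Pq S q' p) q in (Q S q)^T *m (J^T - J) *m Q S q.

(* Row r (1-based) is - z_{r+1} in column 1, 1 in column r+2, 0 elsewhere. *)
Definition chained_annihilator (z : 'cV[R]_m.+3) : 'M[R]_(m.+1, m.+3) :=
  \matrix_(i, j) (if (j : nat) == 0%N then - co z i.+2
                  else ((j : nat) == i.+2)%:R).

Record chained_coordinates S := ChainedCoordinates {
  fz : 'cV[R]_m.+3 -> 'cV[R]_m.+3;
  fzi : 'cV[R]_m.+3 -> 'cV[R]_m.+3;
  fzK : cancel fz fzi;
  fziK : cancel fzi fz;
  fz_smooth : smooth fz;
  fzi_smooth : smooth fzi;
  fzi0 : fzi 0 = 0;
  Qz := fun z => jac fz (fzi z) *m Q S (fzi z);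
  Qz_smooth : smooth Qz;
  Qz_annihilator : forall z, chained_annihilator z *m Qz z = 0
}.

Definition fwi (w : 'cV[R]_m.+3) : 'cV[R]_m.+3 :=
  \col_(j < m.+3)
    match (j : nat).+1 with
    | 1 => co w 1
    | 2 => co w 1 * co w 2
           + \sum_(3 <= i < m.+4) ((i - 2)`!)%:R^-1 * co w 1 ^+ (i - 2) * co w i
    | j' => \sum_(3 <= i < m.+4)
              ((i + j' - 4)`!)%:R^-1 * co w 1 ^+ (i + j' - 4) * co w i
    end.

(* Inverse of the restriction of fwi to w_1 <> 0; its value off the image
   {z_1 <> 0} is a dummy. *)
Definition fw : 'cV[R]_m.+3 -> 'cV[R]_m.+3 :=
  'pinv_(fun=> 0) [set w | co w 1 != 0] fwi.

Section WCoordinates.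
Variables (S : mechanical_system) (Z : chained_coordinates S).

Definition Mz z : 'M[R]_2 := Mq S (fzi Z z).
Definition Cz z (p : 'cV[R]_2) : 'M[R]_2 := Cq S (fzi Z z) p.
Definition Dz z (p : 'cV[R]_2) : 'M[R]_2 := Dq S (fzi Z z) p.

Definition Qw w : 'M[R]_(m.+3, 2) := jac fw (fwi w) *m Qz Z (fwi w).
Definition Mw w : 'M[R]_2 := Mz (fwi w).
Definition Cw w (p : 'cV[R]_2) : 'M[R]_2 := Cz (fwi w) p.
Definition Dw w (p : 'cV[R]_2) : 'M[R]_2 := Dz (fwi w) p.

Variables (Dhat : 'M[R]_2) (k : R) (l : 'rV[R]_m.+3).

Definition Hd (w : 'cV[R]_m.+3) (p : 'cV[R]_2) : R :=
  2^-1 * (p^T *m invmx (Mw w) *m p) 0 0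
  + 2^-1 * (w^T *m diag_mx l *m w) 0 0.

Definition Dd (w : 'cV[R]_m.+3) (p : 'cV[R]_2) : 'M[R]_2 :=
  let e1 : 'cV[R]_m.+3 := delta_mx ord0 0 in
  Dw w p + Dhat + (k / co w 1 ^+ 2) *: ((Qw w)^T *m e1 *m e1^T *m Qw w).

(* The state is the stacked vector x = (w, p). *)
Definition state_w (x : 'cV[R]_(m.+3 + 2)) : 'cV[R]_m.+3 := usubmx x.
Definition state_p (x : 'cV[R]_(m.+3 + 2)) : 'cV[R]_2 := dsubmx x.

Definition closed_loop_field (x : 'cV[R]_(m.+3 + 2)) : 'cV[R]_(m.+3 + 2) :=
  let w := state_w x in let p := state_p x in
  block_mx 0 (Qw w) (- (Qw w)^T) (Cw w p - Dd w p)
  *m col_mx (grad (fun w' => Hd w' p) w) (grad (fun p' => Hd w p') p).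

Definition time_domain (t0 : R) (T : \bar R) : set R :=
  [set t | t0 <= t /\ (t%:E < T)%E].

(* Solution on [t0, T[ in the state space w_1 <> 0; T may be +oo.  Continuity
   at t0 is one-sided, and the equation is imposed on ]t0, T[. *)
Definition is_solution (t0 : R) (T : \bar R) (x : R -> 'cV[R]_(m.+3 + 2)) :=
  [/\ {within time_domain t0 T, continuous x},
      forall t, time_domain t0 T t -> co (state_w (x t)) 1 != 0 &
      forall t, t0 < t -> (t%:E < T)%E ->
        is_derive t 1 x (closed_loop_field (x t))].

(* A solution that has no extension to a strictly longer interval [t0, T'[. *)
Definition is_maximal_solution (t0 : R) (T : \bar R)
    (x : R -> 'cV[R]_(m.+3 + 2)) :=
  [/\ (t0%:E < T)%E, is_solution t0 T x &
      forall (T' : \bar R) (x' : R -> 'cV[R]_(m.+3 + 2)),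
        (T < T')%E -> is_solution t0 T' x' ->
        ~ (forall t, time_domain t0 T t -> x' t = x t)].

End WCoordinates.
End System.

(* Main.v *)
Require Import Defs.
From HB Require Import structures.
From mathcomp Require Import all_boot all_order all_algebra.
From mathcomp Require Import all_classical all_reals all_analysis.
From mathcomp Require Import ring lra zify.

(* Along solutions the energy Hd decreases at rate v^T Dd v with v = grad_p Hd,
   since C_w is skew.  Hence trajectories are bounded, and the k / w_1^2 term of
   Dd controls (w_1' / w_1)^2, which makes w_1^2 exp(t - Hd / k) nondecreasing:
   w_1 cannot reach 0 in finite time.  A maximal solution with a finite end
   point would therefore converge inside {w_1 <> 0} and could be continued by
   Peano's theorem, so T = +oo.
     At a cluster point of the trajectory with w_1 <> 0, LaSalle's argument
   gives p = 0 and then p' = - Q_w^T L w = 0.  The image of Q_w is the kernel of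
   the chained annihilator composed with the Jacobian of f_w^-1; it contains e_2,
   so w_2 = 0, and when w_2 = 0 it contains e_1, so w_1 = 0, a contradiction.
   Thus w_1 -> 0, and every coordinate of f_w^-1(w) has a factor w_1. *)

Set Implicit Arguments.
Unset Strict Implicit.
Unset Printing Implicit Defensive.

Import Order.TTheory GRing.Theory Num.Theory.
Import numFieldNormedType.Exports.

Local Open Scope classical_set_scope.
Local Open Scope ring_scope.


(** * Continuously differentiable maps *)

(** The field is singular on w_1 = 0, the very set that the trajectory approaches, so nothing can be
    evaluated at a limit point before w_1 <> 0 is known there. This is why regularity and LaSalle's
    argument are stated at a point or in a small ball. Only continuity of the field is established,
    which yields existence but neither uniqueness nor a flow. Invariance of the limit set is
    therefore replaced by estimates along the one given trajectory: the field is bounded near a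
    cluster point, so every visit there lasts a fixed time. The weight exp(t - Hd / k) comes from
    Hd' <= - k (w_1' / w_1)^2: the logarithmic derivative of w_1^2 exp(t - Hd / k) is at least 2
    w_1' / w_1 + 1 + (w_1' / w_1)^2 = (1 + w_1' / w_1)^2. The factor exp(t) costs only a constant on
    a bounded time interval. The inverse factorials in f_w^-1 make the w_1-derivative of z_j equal
    to z_{j-1} for j >= 4 and to z_2 - w_1 w_2 for j = 3. The chained annihilator compares exactly
    these quantities, so w_2 alone obstructs e_1 from lying in the image of Q_w. *)

Section C1.
Context {R : realType}.
Implicit Types V W : normedModType R.

(** Local at [x], because [fw] and [invmx] are regular only near suitable points. Continuity is
    asked of each directional derivative separately, the form in which entries of [jac] and [grad]
    use it. *)
Definition C1at V W (f : V -> W) (x : V) : Prop :=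
  (\forall y \near x, differentiable f y) /\
  forall v, {for x, continuous (fun y => 'D_v f y)}.

Lemma C1at_diff V W (f : V -> W) x : C1at f x -> differentiable f x.
Proof. by move=> [/nbhs_singleton]. Qed.

Lemma C1at_continuous V W (f : V -> W) x : C1at f x -> {for x, continuous f}.
Proof. by move=> /C1at_diff/differentiable_continuous. Qed.

Lemma smooth_C1at V W (f : V -> W) x : smooth f -> C1at f x.
Proof.
move=> /(_ 1) [df cf]; split; first exact: nearW.
by move=> v; apply: cf.
Qed.

Lemma smooth_continuous V W (f : V -> W) : smooth f -> continuous f.
Proof. by move=> /(_ 0). Qed.

Lemma for_continuous_near V W (f g : V -> W) (x : V) :
  {near x, f =1 g} -> {for x, continuous f} -> {for x, continuous g}.
Proof.
move=> fg cf; rewrite /prop_for /continuous_at -(nbhs_singleton fg).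
by apply: cvg_trans cf; exact: near_eq_cvg.
Qed.

(** Both maps have the same first-order expansion at [x], and a continuous linear map occurring in
    such an expansion is the differential. *)
Lemma near_eq_differentiable V W (f g : V -> W) (x : V) :
  {near x, f =1 g} -> differentiable f x -> differentiable g x.
Proof.
move=> fg df; have fgx := nbhs_singleton fg.
have E : g \o shift x = cst (g x) + 'd f x +o_ 0 id.
  have /eqaddoP Ef := diff_locally df.
  have fgs : \forall h \near 0, f (h + x) = g (h + x).
    by move: fg; rewrite (near_shift 0 x) subr0.
  apply/eqaddoP => e e0; near=> h.
  have fgh : f (h + x) = g (h + x) by near: h.
  have : `|(f \o shift x - (cst (f x) + 'd f x)) h| <= e * `|id h|.
    by near: h; exact: Ef.
  by rewrite !fctE /= fgh fgx.
have dfc : continuous ('d f x) by exact: diff_continuous.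
by apply/diff_locallyP; rewrite (diff_unique dfc E).
Unshelve. all: by end_near. Qed.

Lemma continuous_at_sum (T : topologicalType) W I (r : seq I) (F : I -> T -> W) x :
  (forall i, {for x, continuous (F i)}) ->
  {for x, continuous (fun y => \sum_(i <- r) F i y)}.
Proof.
move=> CF; elim: r => [|i r IH].
  rewrite (_ : (fun y => _) = fun=> 0); first exact: cst_continuous.
  by apply/funext => y; rewrite big_nil.
rewrite (_ : (fun y => _) = fun y => F i y + \sum_(j <- r) F j y).
  by apply: cvgD; [exact: CF|exact: IH].
by apply/funext => y; rewrite big_cons.
Qed.

Lemma C1at_near V W (f g : V -> W) (x : V) :
  {near x, f =1 g} -> C1at f x -> C1at g x.
Proof.
move=> fg [df cf].
have fg2 : \forall y \near x, {near y, f =1 g} by exact: near_join.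
split.
  near=> y; apply: (@near_eq_differentiable _ _ f); by near: y.
move=> v; apply: for_continuous_near (cf v).
near=> y; apply: near_eq_derive; near: y; exact: fg2.
Unshelve. all: by end_near. Qed.

Lemma eq_C1at V W (f g : V -> W) x : f =1 g -> C1at f x -> C1at g x.
Proof. by move=> /funext ->. Qed.

Lemma C1at_cst V W (a : W) (x : V) : C1at (fun=> a) x.
Proof.
split; first by apply: nearW => y; exact: differentiable_cst.
move=> v; apply: (@for_continuous_near _ _ (fun=> 0)).
  by apply: nearW => y /=; rewrite derive_cst.
exact: cst_continuous.
Qed.

Lemma C1atD V W (f g : V -> W) x :
  C1at f x -> C1at g x -> C1at (fun y => f y + g y) x.
Proof.
move=> [df cf] [dg cg]; split.
  near=> y; apply: (@differentiableD _ _ _ f g); by near: y.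
move=> v; apply: (@for_continuous_near _ _ (fun y => 'D_v f y + 'D_v g y)).
  near=> y; rewrite -(@deriveD _ _ _ f g)//; apply: diff_derivable; by near: y.
by apply: continuousD; [exact: cf|exact: cg].
Unshelve. all: by end_near. Qed.

Lemma C1atM V (f g : V -> R) x :
  C1at f x -> C1at g x -> C1at (fun y => f y * g y) x.
Proof.
move=> Cf Cg; have [df cf] := Cf; have [dg cg] := Cg; split.
  near=> y; apply: (@differentiableM _ _ f g); by near: y.
move=> v.
apply: (@for_continuous_near _ _ (fun y => f y * 'D_v g y + g y * 'D_v f y)).
  near=> y; rewrite -(@deriveM _ _ f g)//; apply: diff_derivable; by near: y.
apply: (@continuousD _ _ _ (fun y => f y * _) (fun y => g y * _)).
  by apply: (@continuousM _ _ f); [exact: (C1at_continuous Cf)|exact: cg].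
by apply: (@continuousM _ _ g); [exact: (C1at_continuous Cg)|exact: cf].
Unshelve. all: by end_near. Qed.

Lemma C1atZr V W (f : V -> R) (a : W) x :
  C1at f x -> C1at (fun y => f y *: a) x.
Proof.
move=> [df cf]; split.
  near=> y; apply: differentiableZl; by near: y.
move=> v.
apply: (@for_continuous_near _ _ (fun y => 'D_v f y *: a)).
  near=> y.
  have dfy : differentiable f y by near: y.
  by rewrite !deriveE ?diffZl//; exact: differentiableZl.
by apply: continuousZr_tmp; exact: cf.
Unshelve. all: by end_near. Qed.

Lemma C1atN V W (f : V -> W) x : C1at f x -> C1at (fun y => - f y) x.
Proof.
move=> [df cf]; split.
  near=> y; apply: (@differentiableN _ _ _ f); by near: y.
move=> v; apply: (@for_continuous_near _ _ (fun y => - 'D_v f y)).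
  near=> y; rewrite -(@deriveN _ _ _ f)//; apply: diff_derivable; by near: y.
by apply: continuousN; exact: cf.
Unshelve. all: by end_near. Qed.

Lemma C1atV V (f : V -> R) x :
  f x != 0 -> C1at f x -> C1at (fun y => (f y)^-1) x.
Proof.
move=> fx0 Cf; have [df cf] := Cf.
have cfx := C1at_continuous Cf.
have f0 : \forall y \near x, f y != 0 by exact: (cvgr_neq0 _ cfx fx0).
split.
  near=> y; apply: (@differentiableV _ _ f); by near: y.
move=> v.
apply: (@for_continuous_near _ _ (fun y => - (f y * f y)^-1 * 'D_v f y)).
  near=> y; rewrite (@deriveV _ _ f)//; last by apply: diff_derivable; near: y.
  by near: y.
apply: (@continuousM _ _ (fun y => - (f y * f y)^-1)); last exact: cf.
apply: continuousN; apply: (@continuousV _ _ (fun y => f y * f y)).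
  by rewrite mulf_neq0.
by apply: (@continuousM _ _ f f).
Unshelve. all: by end_near. Qed.

Lemma C1at_sum V W I (r : seq I) (P : pred I) (F : I -> V -> W) x :
  (forall i, P i -> C1at (F i) x) ->
  C1at (fun y => \sum_(i <- r | P i) F i y) x.
Proof.
move=> CF; elim: r => [|i r IH].
  by apply: (@eq_C1at _ _ (fun=> 0)); [move=> y; rewrite big_nil|exact: C1at_cst].
case Pi : (P i); last by apply: eq_C1at IH => y; rewrite big_cons Pi.
by apply: eq_C1at (C1atD (CF i Pi) IH) => y; rewrite big_cons Pi.
Qed.

Lemma C1at_prod V I (r : seq I) (P : pred I) (F : I -> V -> R) x :
  (forall i, P i -> C1at (F i) x) ->
  C1at (fun y => \prod_(i <- r | P i) F i y) x.
Proof.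
move=> CF; elim: r => [|i r IH].
  by apply: (@eq_C1at V R (fun=> 1)); [move=> y; rewrite big_nil|exact: C1at_cst].
case Pi : (P i); last by apply: eq_C1at IH => y; rewrite big_cons Pi.
by apply: eq_C1at (C1atM (CF i Pi) IH) => y; rewrite big_cons Pi.
Qed.

Lemma C1atX V (f : V -> R) n x : C1at f x -> C1at (fun y => f y ^+ n) x.
Proof.
move=> Cf; elim: n => [|n IH]; first exact: C1at_cst.
by apply: eq_C1at (C1atM Cf IH) => y; rewrite exprS.
Qed.

Lemma C1at_coord m n i j (x : 'M[R]_(m, n)) :
  C1at (fun y : 'M[R]_(m, n) => y i j) x.
Proof.
have dx : nbhs x (fun y => differentiable (fun y : 'M[R]_(m, n) => y i j) y).
  by apply: filterE => y; exact: differentiable_coord.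
split=> [//|v]; apply: (@for_continuous_near _ _ (fun=> v i j)).
  apply: filterE => y /=.
  have := @derive_mx _ _ _ _ (id : 'M[R]_(m, n) -> _) y v (@derivable_id _ _ y v).
  by rewrite derive_id => /matrixP/(_ i j); rewrite mxE.
exact: cst_continuous.
Qed.

Lemma C1at_mx V m n (f : V -> 'M[R]_(m, n)) x :
  (forall i j, C1at (fun y => f y i j) x) -> C1at f x.
Proof.
move=> Cf; rewrite (_ : f = fun y => \sum_i \sum_j f y i j *: delta_mx i j).
  by apply: C1at_sum => i _; apply: C1at_sum => j _; exact: C1atZr.
by apply/funext => y; exact: matrix_sum_delta.
Qed.

Lemma C1at_id m n (x : 'M[R]_(m, n)) : C1at id x.
Proof. by apply: C1at_mx => i j; exact: C1at_coord. Qed.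

Lemma deriveZsum m (W : normedModType R) (g : 'cV[R]_m -> W) y v :
  differentiable g y ->
  'D_v g y = \sum_i v i 0 *: 'D_(delta_mx i 0) g y.
Proof.
move=> dg; rewrite deriveE// {1}(matrix_sum_delta v) linear_sum.
apply: eq_bigr => i _; rewrite linear_sum big_ord1 linearZ/= deriveE//.
Qed.

Lemma derive_comp_cV V m W (f : V -> 'cV[R]_m) (g : 'cV[R]_m -> W) x v :
  differentiable f x -> differentiable g (f x) ->
  'D_v (g \o f) x = 'D_('D_v f x) g (f x).
Proof.
move=> df dg; rewrite !deriveE//; last exact: differentiable_comp.
by rewrite diff_comp.
Qed.

(** The chain rule gives a derivative of [g] along a direction that moves with the point. Expanding
    that direction in the standard basis of the intermediate space reduces continuity to fixed
    directions. *)
Lemma C1at_comp V m W (f : V -> 'cV[R]_m) (g : 'cV[R]_m -> W) x :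
  C1at f x -> C1at g (f x) -> C1at (fun y => g (f y)) x.
Proof.
move=> Cf Cg; have [df cf] := Cf; have [dg cg] := Cg.
have cfx := C1at_continuous Cf.
have dgf : \forall y \near x, differentiable g (f y) by exact: (cfx _ dg).
split.
  near=> y; apply: differentiable_comp; by near: y.
move=> v.
apply: (@for_continuous_near _ _
  (fun y => \sum_i ('D_v f y) i 0 *: 'D_(delta_mx i 0) g (f y))).
  near=> y.
  have dfy : differentiable f y by near: y.
  have dgy : differentiable g (f y) by near: y.
  by rewrite -(deriveZsum _ dgy) -derive_comp_cV.
apply: continuous_at_sum => i; apply: cvgZ.
  apply: (@continuous_comp _ _ _ (fun y => 'D_v f y) (fun M : 'cV[R]_m => M i 0)).
    exact: cf.
  exact: coord_continuous.
apply: (@continuous_comp _ _ _ f (fun y => 'D_(delta_mx i 0) g y)).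
  exact: cfx.
exact: cg.
Unshelve. all: by end_near. Qed.

Lemma C1at_mxE V m n (f : V -> 'M[R]_(m, n)) x i j :
  C1at f x -> C1at (fun y => f y i j) x.
Proof.
move=> Cf; have [df cf] := Cf; split.
  near=> y.
  apply: (@differentiable_comp _ _ _ _ f (fun M : 'M[R]_(m, n) => M i j)).
    by near: y.
  exact: differentiable_coord.
move=> v; apply: (@for_continuous_near _ _ (fun y => ('D_v f y) i j)).
  near=> y; rewrite derive_mx ?mxE//; apply: diff_derivable; by near: y.
apply: (@continuous_comp _ _ _ (fun y => 'D_v f y) (fun M : 'M[R]_(m, n) => M i j)).
  exact: cf.
exact: coord_continuous.
Unshelve. all: by end_near. Qed.

Lemma C1at_mulmx V m n p (f : V -> 'M[R]_(m, n)) (g : V -> 'M[R]_(n, p)) x :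
  C1at f x -> C1at g x -> C1at (fun y => f y *m g y) x.
Proof.
move=> Cf Cg; apply: C1at_mx => i j.
apply: (@eq_C1at _ _ (fun y => \sum_h f y i h * g y h j)) => [y|].
  by rewrite mxE.
by apply: C1at_sum => h _; apply: C1atM; exact: C1at_mxE.
Qed.

Lemma C1at_trmx V m n (f : V -> 'M[R]_(m, n)) x :
  C1at f x -> C1at (fun y => (f y)^T) x.
Proof.
move=> Cf; apply: C1at_mx => i j.
by apply: eq_C1at (C1at_mxE j i Cf) => y; rewrite mxE.
Qed.

Lemma C1at_det V n (f : V -> 'M[R]_n) x :
  C1at f x -> C1at (fun y => \det (f y)) x.
Proof.
move=> Cf; apply: C1at_sum => s _; apply: C1atM; first exact: C1at_cst.
by apply: C1at_prod => i _; exact: C1at_mxE.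
Qed.

(** Cramer's rule. It describes [invmx] only where the determinant is nonzero, hence the detour
    through a neighbourhood of [x]. *)
Lemma C1at_invmx V n (f : V -> 'M[R]_n) x :
  f x \in unitmx -> C1at f x -> C1at (fun y => invmx (f y)) x.
Proof.
move=> ux Cf.
have Cd := C1at_det Cf.
have dx : \det (f x) != 0 by rewrite -unitfE.
have du : \forall y \near x, \det (f y) != 0.
  exact: (cvgr_neq0 _ (C1at_continuous Cd) dx).
apply: (@C1at_near _ _ (fun y => (\det (f y))^-1 *: \adj (f y))).
  near=> y; rewrite /invmx unitmxE unitfE ifT//; by near: y.
apply: C1at_mx => i j.
apply: (@eq_C1at _ _ (fun y => (\det (f y))^-1 * cofactor (f y) j i)) => [y|].
  by rewrite !mxE.
apply: C1atM; first exact: C1atV.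
apply: C1atM; first exact: C1at_cst.
apply: C1at_det; apply: C1at_mx => a b.
by apply: eq_C1at (C1at_mxE (lift j a) (lift i b) Cf) => y; rewrite !mxE.
Unshelve. all: by end_near. Qed.

End C1.


(** * Norms and curves in R^n *)

Section MatrixNorm.
Context {R : realType}.

Lemma mx_norm_leP m n (M : 'M[R]_(m, n)) (e : R) : 0 <= e ->
  reflect (forall i j, `|M i j| <= e) (`|M| <= e).
Proof.
move=> e0; rewrite [X in X <= _]mx_normrE; apply: (iffP idP).
  by move=> /bigmax_leP[_ h] i j; exact: (h (i, j)).
by move=> h; apply/bigmax_leP; split => // -[i j] _; exact: h.
Qed.

Lemma mx_norm_coord m n (M : 'M[R]_(m, n)) i j : `|M i j| <= `|M|.
Proof. by have /mx_norm_leP := lexx `|M|; apply. Qed.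

(** Heine-Borel for row vectors, carried over by transposition, which is an isometry for the maximum
    norm. *)
Lemma closed_ball_cV_compact n (a : 'cV[R]_n) (r : R) :
  compact [set x : 'cV[R]_n | `|x - a| <= r].
Proof.
have -> : [set x : 'cV[R]_n | `|x - a| <= r] =
    trmx @` [set x : 'rV[R]_n | `|x - a^T| <= r].
  have normT (x : 'rV[R]_n) : `|x^T - a| = `|x - a^T|.
    apply/eqP; rewrite eq_le; apply/andP; split; apply/mx_norm_leP => // i j.
      by have := mx_norm_coord (x - a^T) j i; rewrite !mxE.
    by have := mx_norm_coord (x^T - a) j i; rewrite !mxE.
  apply/seteqP; split => [x xr|_ [x xr <-]] /=; last by rewrite normT.
  by exists x^T; rewrite ?trmxK//= -normT trmxK.
apply: continuous_compact.
  apply: continuous_subspaceT => x.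
  exact: (C1at_continuous (C1at_trmx (C1at_id x))).
apply: bounded_closed_compact.
  exists (r + `|a^T|); split; first by rewrite num_real.
  move=> M rM x /= xr; rewrite -(subrK a^T x) (le_trans (ler_normD _ _))//.
  by rewrite (le_trans _ (ltW rM))// lerD2r.
apply: (@closed_comp _ _ (fun x : 'rV[R]_n => `|x - a^T|) [set y | y <= r]).
  move=> x _; apply: (@continuous_comp _ _ _ (fun x : 'rV[R]_n => x - a^T)
      (fun y : 'rV[R]_n => `|y|)).
    exact: (C1at_continuous (C1atD (C1at_id x) (C1at_cst (- a^T) x))).
  exact: norm_continuous.
exact: closed_le.
Qed.

End MatrixNorm.

Section RealCurves.
Context {R : realType}.

(** A division-free form of the derivative that can be checked separately on each side of [s]. This
    is how two solutions are glued at a common end point. *)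
Lemma is_derive_epsP (W : normedModType R) (f : R -> W) (s : R) (d : W) :
  (forall e, 0 < e -> \forall t \near s, `|f t - f s - (t - s) *: d| <= e * `|t - s|) <->
  is_derive s 1 f d.
Proof.
split=> [h|[fs <-] e e0].
  have cvgd : h^-1 *: ((f \o shift s) (h *: 1) - f s) @[h --> 0^'] --> d.
    apply/cvgrPdist_le => e e0.
    have := h _ e0; rewrite (near_shift 0 s) subr0 => /= he.
    near=> k.
    have k0 : k != 0 by near: k; exact: nbhs_dnbhs_neq.
    have : `|f (k + s) - f s - (k + s - s) *: d| <= e * `|k + s - s|.
      by near: k; exact: nbhs_dnbhs.
    rewrite addrK => hk.
    rewrite /= [k *: 1]mulr1 distrC.
    rewrite -(scalerK k0 d) -scalerBr normrZ normfV ler_pdivrMl ?normr_gt0//.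
    by rewrite mulrC.
  by apply: DeriveDef; [apply/cvg_ex; exists d|exact: cvg_lim].
have /diff_locally/eqaddoP : differentiable f s by exact/derivable1_diffP.
move=> /(_ e e0) h0.
have h : \forall h \near (0 : R), `|f (h + s) - f s - h *: 'D_1 f s| <= e * `|h|.
  apply: filterS h0 => h; rewrite !fctE /= opprD addrA diff1E ?derive1E//.
  exact/derivable1_diffP.
by move: h; rewrite (near_shift s 0) sub0r => /=; apply: filterS => t /=; rewrite subrK.
Unshelve. all: by end_near. Qed.

Lemma derive_continuous (W : normedModType R) (f : R -> W) (s : R) (d : W) :
  is_derive s 1 f d -> {for s, continuous f}.
Proof.
by move=> [fs _]; apply: differentiable_continuous; exact/derivable1_diffP.
Qed.

Lemma is_derive_mxE m n (f : R -> 'M[R]_(m, n)) (s : R) (d : 'M[R]_(m, n)) i j :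
  is_derive s 1 f d -> is_derive s 1 (fun t => f t i j) (d i j).
Proof.
move=> [fs <-]; rewrite derive_mx// mxE; apply: derivableP.
by move/derivable_mxP : fs; apply.
Qed.

(** The mean value theorem in each coordinate; the norm is the maximum of the coordinates, so no
    constant is lost. It is used with [c] = 0 as a Lipschitz bound and with [c] = [F a] as a
    first-order expansion. *)
Lemma mean_value_ineq n (f df : R -> 'cV[R]_n) (c : 'cV[R]_n) (B a b : R) :
  a <= b -> 0 <= B -> {within `[a, b], continuous f} ->
  (forall t, a < t < b -> is_derive t 1 f (df t)) ->
  (forall t, a < t < b -> `|df t - c| <= B) ->
  `|f b - f a - (b - a) *: c| <= B * (b - a).
Proof.
move=> ab B0 cf dfE dfB; have ba0 : 0 <= b - a by rewrite subr_ge0.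
apply/mx_norm_leP => [|i j]; first by rewrite mulr_ge0.
have cfij : {within `[a, b], continuous (fun t => f t i j)}.
  move=> t; apply: (@continuous_comp _ _ _ (f : subspace _ -> _)
    (fun M : 'M[R]_(n, 1) => M i j)); [exact: cf|exact: coord_continuous].
move: ab; rewrite le_eqVlt => /predU1P[ab|ab].
  by rewrite !mxE -ab !subrr mul0r subr0 normr0 mulr0.
have dfij t : t \in `]a, b[%R -> is_derive t 1 (fun t => f t i j) (df t i j).
  by rewrite in_itv => /dfE; exact: is_derive_mxE.
have [t tab E] := MVT ab dfij cfij.
have -> : (f b - f a - (b - a) *: c) i j = (df t - c) i j * (b - a).
  by rewrite !mxE E; ring.
rewrite normrM (ger0_norm ba0) ler_wpM2r//.
apply: (le_trans (mx_norm_coord _ _ _)); apply: dfB.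
by move: tab; rewrite in_itv.
Qed.

End RealCurves.


(** * Peano's existence theorem *)

Section Peano.
Context {R : realType}.

(** Compactness gives a cluster point, and for an ultrafilter a cluster point is a limit: the
    preimage of a neighbourhood or that of its complement belongs to [U]. *)
Lemma ultra_cvg_compact (I : Type) (T : topologicalType) (U : set_system I)
    (f : I -> T) (K : set T) :
  UltraFilter U -> compact K -> (forall i, K (f i)) ->
  exists2 p, K p & f @ U --> p.
Proof.
move=> UU cK fK; have PU := @ultra_proper _ _ UU.
have [p [Kp clp]] : K `&` cluster (f @ U) !=set0.
  by apply: cK; exact: (@filterE _ U).
exists p => // W Wp; have [//|nW] := in_ultra_setVsetC (f @^-1` W) UU.
by have [z [nWz Wz]] := clp (~` W) W nW Wp.
Qed.

Variables (n : nat) (F : 'cV[R]_n -> 'cV[R]_n) (x0 : 'cV[R]_n).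

Definition euler (h : R) i := iter i (fun y => y + h *: F y) x0.

(** Each Euler step deviates from [h *: v] by at most [h * e], and these errors add up over the
    [i - j] steps. *)
Lemma euler_close h i j v e : 0 <= h -> (j <= i)%N ->
  (forall k, (j <= k < i)%N -> `|F (euler h k) - v| <= e) ->
  `|euler h i - euler h j - ((i - j)%:R * h) *: v| <= (i - j)%:R * h * e.
Proof.
move=> h0; elim: i => [|i IH].
  by rewrite leqn0 => /eqP-> _; rewrite subrr subnn !mul0r scale0r subr0 normr0.
rewrite leq_eqVlt => /predU1P[->|ji] Fk.
  by rewrite subrr subnn !mul0r scale0r subr0 normr0.
rewrite ltnS in ji.
rewrite subSn// -natr1 !mulrDl !mul1r scalerDl.
have -> : euler h i.+1 - euler h j - (((i - j)%:R * h) *: v + h *: v) =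
   (euler h i - euler h j - ((i - j)%:R * h) *: v) + h *: (F (euler h i) - v).
  rewrite /euler iterS scalerBr -/(euler h i) -/(euler h j).
  by rewrite opprD [_ + _ - euler h j]addrAC addrACA.
rewrite (le_trans (ler_normD _ _))// lerD//.
  by apply: IH => // k /andP[jk ki]; apply: Fk; rewrite jk ltnW.
by rewrite normrZ (ger0_norm h0) ler_wpM2l// Fk// ji ltnS leqnn.
Qed.

Variables (r B tau : R).
Hypotheses (B0 : 0 <= B) (tau0 : 0 < tau) (Btau : B * tau <= r).
Hypothesis FB : forall z, `|z - x0| <= r -> `|F z| <= B.

Lemma euler_ball h i : 0 <= h -> i%:R * h <= tau -> `|euler h i - x0| <= r.
Proof.
move=> h0 ih.
(* The induction needs the sharper bound, which grows with [i]: a node must be known to lie in the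
   ball before the field can be bounded there. *)
suff H : `|euler h i - x0| <= i%:R * h * B.
  by rewrite (le_trans H)// (le_trans _ Btau)// mulrC ler_wpM2l.
elim: i ih => [|i IH] ih; first by rewrite subrr normr0 !mul0r.
have ih' : i%:R * h <= tau.
  by rewrite (le_trans _ ih)// ler_wpM2r// ler_nat.
rewrite {1}/euler iterS -/(euler h i) addrAC (le_trans (ler_normD _ _))//.
rewrite -natr1 !mulrDl mul1r lerD ?IH//.
rewrite normrZ ger0_norm// ler_wpM2l// FB//.
by rewrite (le_trans (IH ih'))// (le_trans _ Btau)// mulrC ler_wpM2l.
Qed.

Lemma truncn_step (h t : R) : 0 < h -> 0 <= t ->
  (Num.truncn (t / h))%:R * h <= t < (Num.truncn (t / h))%:R * h + h.
Proof.
move=> h0 t0; have := truncn_itv (divr_ge0 t0 (ltW h0)).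
by rewrite ler_pdivlMr// ltr_pdivrMr// -natr1 mulrDl mul1r.
Qed.

(** The nodes between times [a] and [b] stay within [(b - a + h) * B] of [u s], hence in the ball
    where [F] is close to [v]. Rounding both times to the grid changes [b - a] by at most [h], which
    produces the last term. The base point [s] may be either end, so that both one-sided estimates
    follow. *)
Lemma euler_secant (h a b s e d : R) (v ys : 'cV[R]_n) (u : R -> 'cV[R]_n) :
  u = (fun t => euler h (Num.truncn (t / h))) ->
  0 < h -> 0 <= a -> a <= b -> b < tau -> s = a \/ s = b -> 0 <= e ->
  (forall z, `|z - ys| < d -> `|F z - v| <= e) ->
  `|u s - ys| < d / 2 -> (b - a + h) * B <= d / 2 ->
  `|u b - u a - (b - a) *: v| <= e * (b - a) + h * (e + `|v|).
Proof.
move=> uE h0 a0 ab bt sab e0 Fv us dB; have b0 := le_trans a0 ab.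
have uaE : u a = euler h (Num.truncn (a / h)) by rewrite uE.
have ubE : u b = euler h (Num.truncn (b / h)) by rewrite uE.
have := truncn_step h0 a0; have := truncn_step h0 b0.
have ji : (Num.truncn (a / h) <= Num.truncn (b / h))%N.
  by apply: le_truncn; rewrite ler_wpM2r// invr_ge0 ltW.
move: ji uaE ubE; set j := Num.truncn (a / h); set i := Num.truncn (b / h).
move=> ji uaE ubE /andP[ib bi] /andP[ja aj].
have ijE : (i - j)%:R * h = i%:R * h - j%:R * h by rewrite natrB// mulrBl.
have ballk k : (k <= i)%N -> `|F (euler h k)| <= B.
  move=> ki; apply: FB; apply: euler_ball; first exact: ltW.
  rewrite (le_trans _ (ltW bt))// (le_trans _ ib)// ler_wpM2r ?(ltW h0)//.
  by rewrite ler_nat.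
have lip k l : (k <= l <= i)%N -> `|euler h l - euler h k| <= (l - k)%:R * h * B.
  move=> /andP[kl li].
  have := @euler_close h l k 0 B (ltW h0) kl; rewrite scaler0 subr0; apply.
  move=> p /andP[_ pl]; rewrite subr0 ballk//.
  exact: leq_trans (ltnW pl) li.
have lips k : (j <= k <= i)%N -> `|euler h k - u s| <= (b - a + h) * B.
  move=> /andP[jk ki].
  have le2 l : (l <= i - j)%N -> l%:R * h * B <= (b - a + h) * B.
    move=> lij; rewrite ler_wpM2r//.
    have : l%:R * h <= (i - j)%:R * h by rewrite ler_wpM2r ?(ltW h0)// ler_nat.
    rewrite ijE; lra.
  case: sab => ->; rewrite ?uaE ?ubE.
    by rewrite (le_trans (lip j k _))// ?jk// le2// leq_sub2r.
  by rewrite distrC (le_trans (lip k i _))// ?ki ?leqnn// le2// leq_sub2l.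
have close k : (j <= k < i)%N -> `|F (euler h k) - v| <= e.
  move=> /andP[jk ki]; apply: Fv.
  rewrite -(subrKA (u s)) (le_lt_trans (ler_normD _ _))//.
  have := lips k; rewrite jk (ltnW ki) => /(_ isT); lra.
have := @euler_close h i j v e (ltW h0) ji close; rewrite -uaE -ubE => H.
rewrite -(subrKA (((i - j)%:R * h) *: v)) (le_trans (ler_normD _ _))//.
rewrite -scalerBl normrZ.
have : `|(i - j)%:R * h - (b - a)| <= h.
  rewrite ijE ler_norml; apply/andP; split; lra.
move=> /(ler_wpM2r (normr_ge0 v)) H2.
have := lerD H H2; move=> /le_trans; apply.
have : (i - j)%:R * h * e <= (b - a + h) * e by rewrite ler_wpM2r// ijE; lra.
lra.
Qed.

Hypothesis Fc : forall z, `|z - x0| <= r -> {for z, continuous F}.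

(* Pointwise limits of the Euler polygons along an ultrafilter replace the
   extraction of a uniformly convergent subsequence. *)
Lemma peano : exists y : R -> 'cV[R]_n,
  [/\ y 0 = x0, forall t, 0 <= t < tau -> `|y t - x0| <= r &
  forall s : R, 0 <= s < tau -> forall e : R, 0 < e -> exists2 d : R, 0 < d &
    forall t : R, 0 <= t < tau -> `|t - s| < d ->
    `|y t - y s - (t - s) *: F (y s)| <= e * `|t - s|].
Proof.
have [U [UU Uoo]] := ultraFilterLemma (eventually_filter).
have PU := @ultra_proper _ _ UU.
pose h (k : nat) : R := k.+1%:R^-1.
have h0 k : 0 < h k by rewrite invr_gt0.
have hU : h @ U --> 0 by apply: cvg_trans (@cvg_harmonic R); exact: cvg_app.
pose N k t := Num.truncn (t / h k).
pose u t k := euler (h k) (N k t).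
have ub (t : R) k : 0 <= t < tau -> `|u t k - x0| <= r.
  move=> /andP[t0 tt]; apply: euler_ball; first exact: ltW.
  by have /andP[/le_trans->//] := truncn_step (h0 k) t0; exact: ltW.
(* The pointwise limit along [U]; the value 0 outside [[0, tau[] is a default. *)
have /choice[y yP] (t : R) : exists p, 0 <= t < tau ->
    `|p - x0| <= r /\ u t @ U --> p.
  have [tt|tt] := boolP (0 <= t < tau); last by exists 0.
  have [p ? ?] := ultra_cvg_compact UU (@closed_ball_cV_compact R n x0 r)
    (fun k => ub t k tt).
  by exists p.
have y0 : y 0 = x0.
  have [|_] := yP 0; first by rewrite lexx.
  rewrite (_ : u 0 = fun=> x0); last first.
    by apply/funext => k; rewrite /u /N mul0r truncn0.
  by move=> /cvg_lim <- //; rewrite lim_cst.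
exists y; split => [//|t /yP[]//|s ss e e0].
have [/Fc Fcs us] := yP s ss.
have [d0 d00 Fd] : exists2 d : R, 0 < d &
    forall z, `|z - y s| < d -> `|F z - F (y s)| <= e.
  have /cvgrPdist_le/(_ e e0)/nbhs_normP[d d0 Fd] := Fcs.
  by exists d => // z zd; rewrite distrC; apply: Fd; rewrite /= distrC.
(* With [|t - s|] and the step both below [d], the polygon moves by at most [2 * d * (B + 1)] =
   [d0 / 2]. *)
pose d := d0 / (4 * (B + 1)).
have B1 : 0 < B + 1 by rewrite ltr_wpDl.
have d_gt0 : 0 < d by rewrite divr_gt0// mulr_gt0.
exists d => // t tt ts.
have [_ ut] := yP t tt.
have uts : (fun k => `|u t k - u s k - (t - s) *: F (y s)|) @ U -->
    `|y t - y s - (t - s) *: F (y s)|.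
  by apply: cvg_norm; apply: cvgB; [exact: cvgB|exact: cvg_cst].
(* The rounding error carries the factor [h k] and disappears in the limit. *)
have bd : (fun k => e * `|t - s| + h k * (e + `|F (y s)|)) @ U -->
    e * `|t - s| + 0 * (e + `|F (y s)|).
  by apply: cvgD; [exact: cvg_cst|apply: cvgM => //; exact: cvg_cst].
rewrite mul0r addr0 in bd.
apply: (ler_cvg_to uts bd).
have hd : \forall k \near U, h k < d by exact: (cvgr_lt _ hU).
have usd : \forall k \near U, `|y s - u s k| < d0 / 2.
  by move/cvgrPdist_lt : us; apply; rewrite divr_gt0.
near=> k.
have hkd : h k < d by near: k.
have uskd : `|u s k - y s| < d0 / 2 by rewrite distrC; near: k.
have small (q : R) : 0 <= q -> q < d -> (q + h k) * B <= d0 / 2.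
  move=> q0 qd; apply: (@le_trans _ _ (2 * d * (B + 1))).
    apply: ler_pM => //; [by rewrite addr_ge0// ltW|lra|lra].
  have -> : 2 * d * (B + 1) = d0 / 2 by rewrite /d; field; rewrite gt_eqF.
  by [].
move: ss tt => /andP[s0 sT] /andP[t0 tT].
have [st|st] := leP s t.
  rewrite (ger0_norm (_ : 0 <= t - s)) ?subr_ge0// in ts *.
  apply: (@euler_secant (h k) s t s e d0 _ (y s) (u ^~ k)) => //.
  - by left.
  - exact: ltW.
  - by apply: small => //; rewrite subr_ge0.
have -> : u t k - u s k - (t - s) *: F (y s) =
    - (u s k - u t k - (s - t) *: F (y s)).
  by rewrite -(opprB s t) scaleNr [in RHS]opprB [in RHS]opprB opprK addrC.
have ts0 : 0 <= s - t by rewrite subr_ge0 ltW.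
rewrite normrN (distrC t s) (ger0_norm ts0).
rewrite (distrC t s) (ger0_norm ts0) in ts.
apply: (@euler_secant (h k) t s s e d0 _ (y s) (u ^~ k)) => //.
- exact: ltW.
- by right.
- exact: ltW.
- exact: small.
Unshelve. all: by end_near. Qed.

End Peano.


(** * Continuation of solutions *)

Section ODE.
Context {R : realType} {n : nat}.
Implicit Types (F : 'cV[R]_n -> 'cV[R]_n) (x : R -> 'cV[R]_n).

(** The Lipschitz bound keeps the curve in a compact ball as t tends to T, so it has a cluster point
    there; the same bound makes this point the limit and gives the rate. *)
Lemma lipschitz_left_limit x (t0 T B : R) : t0 < T ->
  (forall s t, t0 < s -> s <= t -> t < T -> `|x t - x s| <= B * (t - s)) ->
  exists a, forall t, t0 < t < T -> `|x t - a| <= B * (T - t).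
Proof.
move=> t0T lip.
pose c := (t0 + T) / 2; have t0c : t0 < c by rewrite /c; lra.
have cT : c < T by rewrite /c; lra.
have B0 : 0 <= B.
  have d0 : 0 < (c + T) / 2 - c by rewrite /c; lra.
  rewrite -(pmulr_lge0 _ d0) (le_trans (normr_ge0 (x ((c + T) / 2) - x c)))//.
  by apply: lip => //; rewrite /c; lra.
have [a [Ka cla]] : [set z | `|z - x c| <= B * (T - c)] `&` cluster (x @ T^'-) !=set0.
  apply: (@closed_ball_cV_compact _ _ (x c) (B * (T - c))).
  suff : \forall t \near T^'-, `|x t - x c| <= B * (T - c) by [].
  near=> t.
  have ct : c < t by near: t; exact: nbhs_left_gt.
  have tT : t < T by near: t; exact: nbhs_left_lt.
  rewrite /= (le_trans (lip c t t0c (ltW ct) tT))// ler_wpM2l//; lra.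
exists a => t /andP[t0t tT]; apply/ler_addgt0Pr => e e0.
have nb : nbhs a [set z | `|a - z| < e] by apply/(nbhs_normP a); exists e.
have [|z [[s ts <-] za]] := cla [set x s | s in [set s | t < s < T]] _ _ nb.
  suff : \forall s \near T^'-, [set x s | s in [set s | t < s < T]] (x s) by [].
  near=> s; exists s => //=; apply/andP; split; near: s.
    exact: nbhs_left_gt.
  exact: nbhs_left_lt.
move: ts => /= /andP[ts sT]; rewrite -(subrKA (x s)) (le_trans (ler_normD _ _))//.
rewrite lerD//; last by rewrite distrC ltW.
rewrite distrC (le_trans (lip t s t0t (ltW ts) sT))// ler_wpM2l//; lra.
Unshelve. all: by end_near. Qed.

Lemma near_dist_lt (s e : R) : 0 < e -> \forall t \near s, `|t - s| < e.
Proof.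
by move=> e0; apply/(nbhs_normP s); exists e => // t; rewrite /= distrC.
Qed.

Lemma continuous_at_ball F a e : 0 < e -> {for a, continuous F} ->
  exists2 r : R, 0 < r & forall z, `|z - a| <= r -> `|F z - F a| <= e.
Proof.
move=> e0 /cvgrPdist_le/(_ e e0)/nbhs_normP[d /= d0 Fd].
exists (d / 2); first by rewrite divr_gt0.
move=> z zd; rewrite distrC; apply: Fd; rewrite /= distrC; lra.
Qed.

(** The curve is followed after [T] by a Peano solution starting at [a]. The delicate point is the
    derivative at [T]: the right side comes from Peano's estimate, the left side from the mean value
    inequality. Staying within [r] of [a] later guarantees w_1 <> 0 on the extension. *)
Lemma ode_extend F x a (t0 T B r : R) : t0 < T -> 0 < r ->
  (forall t, t0 < t -> t < T -> is_derive t 1 x (F (x t))) ->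
  (forall t, t0 < t < T -> `|x t - a| <= B * (T - t)) ->
  (forall z, `|z - a| <= r -> {for z, continuous F}) ->
  exists2 tau : R, 0 < tau & exists y : R -> 'cV[R]_n,
  [/\ forall t, t < T -> y t = x t,
   forall t, t0 < t -> t < T + tau -> is_derive t 1 y (F (y t)) &
   forall t, T <= t -> t < T + tau -> `|y t - a| <= r].
Proof.
move=> t0T r0 dx xa Fc.
have Fa : {for a, continuous F} by apply: Fc; rewrite subrr normr0 ltW.
have [r1 r10 Fr1] := continuous_at_ball ltr01 Fa.
pose r2 := Num.min r r1; have r20 : 0 < r2 by rewrite lt_min r0.
have r2r : r2 <= r by rewrite ge_min lexx.
have r2r1 : r2 <= r1 by rewrite ge_min lexx orbT.
pose B1 := `|F a| + 1; have B10 : 0 < B1 by rewrite ltr_wpDl.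
pose tau := r2 / B1; have tau0 : 0 < tau by rewrite divr_gt0.
have Btau : B1 * tau <= r2 by rewrite /tau mulrCA divff ?mulr1// gt_eqF.
have FB z : `|z - a| <= r2 -> `|F z| <= B1.
  move=> zr; rewrite -(subrK (F a) (F z)) (le_trans (ler_normD _ _))//.
  by rewrite addrC lerD2l Fr1// (le_trans zr).
have Fc2 z : `|z - a| <= r2 -> {for z, continuous F}.
  by move=> zr; apply: Fc; rewrite (le_trans zr).
have [p [p0 pa pP]] := peano (ltW B10) tau0 Btau FB Fc2.
pose y t := if t < T then x t else p (t - T).
have yx t : t < T -> y t = x t by rewrite /y => ->.
have yp t : T <= t -> y t = p (t - T) by rewrite /y ltNge => ->.
have yT : y T = a by rewrite yp// subrr.
exists tau => //; exists y; split => //; last first.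
  move=> t Tt tT; rewrite yp// (le_trans _ r2r)// pa// subr_ge0 Tt/=; lra.
(* This includes [s] = [T], where it is the one-sided derivative from the right. *)
have right s e : T <= s < T + tau -> 0 < e ->
    exists2 d : R, 0 < d & forall t, T <= t -> `|t - s| < d ->
      `|y t - y s - (t - s) *: F (y s)| <= e * `|t - s|.
  move=> /andP[Ts sT] e0.
  have ss : 0 <= s - T < tau by rewrite subr_ge0 Ts/=; lra.
  have [d d0 pd] := pP _ ss e e0.
  exists (Num.min d (T + tau - s)); first by rewrite lt_min d0 subr_gt0.
  move=> t Tt; rewrite lt_min => /andP[td tT].
  have tsE : t - T - (s - T) = t - s by ring.
  rewrite !yp// -tsE; apply: pd; last by rewrite tsE.
  rewrite subr_ge0 Tt/=; move: tT; rewrite ltr_norml; lra.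
have TT : T <= T < T + tau by rewrite lexx ltrDl.
(* Needed before differentiability: the mean value inequality on [[t, T]] uses continuity up to [T]
   and closeness of the field along the curve to [F a]. *)
have cy : {for T, continuous y}.
  have [d d0 rd] := right T 1 TT ltr01.
  apply/cvgrPdist_le => e e0.
  pose C := `|B| + B1; have C0 : 0 < C by rewrite ltr_wpDl.
  near=> t.
  suff : `|y t - a| <= C * `|t - T|.
    rewrite yT distrC => /le_trans; apply.
    rewrite mulrC -ler_pdivlMr// ltW//; near: t.
    by apply: near_dist_lt; rewrite divr_gt0.
  have [tT|Tt] := ltP t T.
    have t0t : t0 < t by near: t; exact: lt_nbhsr.
    rewrite yx// (le_trans (xa t _)) ?t0t// distrC ger0_norm ?subr_ge0 ?(ltW tT)//.
    rewrite ler_wpM2r ?subr_ge0 ?(ltW tT)// (le_trans (ler_norm B))//.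
    by rewrite lerDl ltW.
  rewrite -(subrK ((t - T) *: F a) (y t - a)) (le_trans (ler_normD _ _))// normrZ.
  have : `|y t - y T - (t - T) *: F (y T)| <= 1 * `|t - T|.
    by apply: rd => //; near: t; exact: near_dist_lt.
  rewrite yT mul1r => H; rewrite (le_trans (lerD H (lexx _)))//.
  rewrite -{1}[`|t - T|]mulr1 -mulrDr mulrC ler_wpM2r// /C /B1 [1 + _]addrC.
  by rewrite lerDr.
move=> t t0t tT; have [tltT|] := ltP t T.
  rewrite yx//; apply: (near_eq_is_derive (f := x)); last exact: dx.
  near=> s; rewrite yx//; near: s; exact: lt_nbhsl.
rewrite le_eqVlt => /predU1P[<-|Tt]; last first.
  apply/is_derive_epsP => e e0.
  have [|d d0 rd] := right t e _ e0; first by rewrite ltW.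
  near=> s; apply: rd.
    by apply: ltW; near: s; exact: lt_nbhsr.
  by near: s; exact: near_dist_lt.
clear t t0t tT; rewrite yT; apply/is_derive_epsP => e e0; rewrite yT.
have [d d0 rd] := right T e TT e0; rewrite yT in rd.
have [d1 d10 Fd1] := continuous_at_ball e0 Fa.
have yd1 : \forall t \near T, `|y t - a| <= d1.
  move/cvgrPdist_le : cy => /(_ d1 d10); rewrite yT.
  by apply: filterS => u; rewrite distrC.
have /nbhs_normP[d2 /= d20 yd2] := yd1.
near=> t.
have [tT'|Tt] := ltP t T; last first.
  by apply: rd => //; near: t; exact: near_dist_lt.
have t0t' : t0 < t by near: t; exact: lt_nbhsr.
have tT2 : `|T - t| < d2 by rewrite distrC; near: t; exact: near_dist_lt.
have cyt s : t <= s <= T -> {for s, continuous y}.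
  move=> /andP[ts]; rewrite le_eqVlt => /predU1P[->//|sT].
  apply: (for_continuous_near (f := x)).
    by near=> u; rewrite yx//; near: u; exact: lt_nbhsl.
  by apply: derive_continuous (dx _ _ sT); rewrite (lt_le_trans t0t').
have : `|y T - y t - (T - t) *: F a| <= e * (T - t).
  apply: (mean_value_ineq (df := F \o x)).
  - exact: ltW.
  - exact: ltW.
  - apply: continuous_in_subspaceT => s; rewrite inE/= in_itv/=; exact: cyt.
  - move=> s /andP[ts sT]; apply: (near_eq_is_derive (f := x)).
      by near=> u; rewrite yx//; near: u; exact: lt_nbhsl.
    by apply: dx => //; exact: lt_trans ts.
  - move=> s /andP[ts sT]; apply: Fd1 => /=; rewrite -yx//.
    apply: yd2 => /=; rewrite ger0_norm; last by rewrite subr_ge0 ltW.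
    by move: tT2; rewrite ger0_norm; lra.
rewrite yT => H; have Tt0 : 0 <= T - t by rewrite subr_ge0 ltW.
have -> : y t - a - (t - T) *: F a = - (a - y t - (T - t) *: F a).
  by rewrite -(opprB T t) scaleNr [in RHS]opprB [in RHS]opprB opprK addrC.
by rewrite normrN (distrC t T) (ger0_norm Tt0).
Unshelve. all: by end_near. Qed.

End ODE.


(** * LaSalle's argument *)

Lemma closed_ball_coord_ge_compact (R : realType) n (a : 'cV[R]_n) (r m : R) i :
  compact [set z : 'cV[R]_n | `|z - a| <= r /\ m <= `|z i 0| ].
Proof.
apply: (@compact_closedI _ [set z : 'cV[R]_n | `|z - a| <= r]
  [set z : 'cV[R]_n | m <= `|z i 0|]); first exact: closed_ball_cV_compact.
apply: (@closed_comp _ _ (fun z : 'cV[R]_n => `|z i 0|) [set y | m <= y]).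
  move=> z _; apply: (@continuous_comp _ _ _ (fun z : 'cV[R]_n => z i 0)
    (fun y : R => `|y|)); first exact: coord_continuous.
  exact: norm_continuous.
exact: closed_ge.
Qed.

Section Invariance.
Context {R : realType} {n : nat}.
Variables (F : 'cV[R]_n -> 'cV[R]_n) (x : R -> 'cV[R]_n) (t0 : R).
Hypothesis dx : forall t, t0 < t -> is_derive t 1 x (F (x t)).

Let xc t : t0 < t -> {for t, continuous x}.
Proof. by move=> /dx; exact: derive_continuous. Qed.

(** An exit-time argument. Before the infimum [c] of the times outside the ball the speed is at most
    [B], so the displacement up to [c] is at most [r / 2] and [x c] is still strictly inside.
    Continuity at [c] then contradicts the infimum. *)
Lemma solution_stays a (r B tau s : R) : t0 < s -> 0 <= B -> 0 < r ->
  B * tau <= r / 2 ->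
  (forall z, `|z - a| < r -> `|F z| <= B) -> `|x s - a| < r / 2 ->
  forall t, s <= t <= s + tau -> `|x t - a| < r.
Proof.
move=> t0s B0 r0 Bt FB xs t1 /andP[st1 t1s]; rewrite ltNge; apply/negP => xt1.
pose A : set R := [set t | s <= t /\ r <= `|x t - a|].
have A0 : A !=set0 by exists t1.
have lbA : lbound A s by move=> t [].
have infA : has_inf A by split => //; exists s.
pose c := inf A.
have sc : s <= c by exact: lb_le_inf.
have ct1 : c <= t1 by apply: ge_inf; [exists s|].
have below t : s <= t -> t < c -> `|x t - a| < r.
  move=> st tc; rewrite ltNge; apply/negP => xt.
  by move: tc; rewrite ltNge => /negP; apply; apply: ge_inf; [exists s|].
have xcr : `|x c - a| < r.
  have Bcs : B * (c - s) <= B * tau by rewrite ler_wpM2l//; lra.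
  have : `|x c - x s - (c - s) *: 0| <= B * (c - s).
    apply: (mean_value_ineq (df := F \o x)) => //.
    - apply: continuous_in_subspaceT => t; rewrite inE/= in_itv/= => /andP[st _].
      by apply: xc; exact: lt_le_trans st.
    - by move=> t /andP[st _]; apply: dx; exact: lt_trans st.
    - by move=> t /andP[st tc]; rewrite subr0 FB// below// ltW.
  rewrite scaler0 subr0 => H.
  rewrite -(subrKA (x s)) (le_lt_trans (ler_normD _ _))//; lra.
have cc : {for c, continuous x} by apply: xc; exact: lt_le_trans sc.
have : \forall t \near c, `|x t - a| < r.
  have e0 : 0 < r - `|x c - a| by rewrite subr_gt0.
  move/cvgrPdist_lt : cc => /(_ _ e0); apply: filterS => t xt.
  rewrite -(subrKA (x c)) (le_lt_trans (ler_normD _ _))//.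
  rewrite distrC; lra.
move=> /(nbhs_normP c)[d /= d0 cd].
have [t [st xt] tc] := inf_adherent d0 infA.
have ct : c <= t by apply: ge_inf; [exists s|].
have : `|x t - a| < r.
  by apply: cd => /=; rewrite distrC ger0_norm ?subr_ge0// ltrBlDl.
by rewrite ltNge xt.
Qed.

(** The filter at infinity is restricted to the times spent in [K]. It is proper because those times
    are unbounded, and a cluster point along this finer filter is one along the original. *)
Lemma frequently_cluster (K : set 'cV[R]_n) : compact K ->
  (forall t, exists2 s, t < s & K (x s)) ->
  exists2 a, K a & cluster (x @ +oo) a.
Proof.
move=> cK freq.
pose G : set_system R := within (x @^-1` K) (+oo).
have PG : ProperFilter (x @ G).
  apply: fmap_proper_filter; split; last exact: within_filter.
  rewrite /G /within/= => -[M [_ /= MK]].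
  by have [s Ms Ks] := freq M; exact: (MK s).
have [a [Ka cla]] : K `&` cluster (x @ G) !=set0.
  by apply: cK; exact: withinT.
exists a => // P Q xP Qa; apply: cla Qa.
rewrite /G /fmap /within /= in xP *.
by move: xP; apply: filterS.
Qed.

Lemma cluster_frequently a (r t1 : R) : 0 < r -> cluster (x @ +oo) a ->
  exists2 s, t1 < s & `|x s - a| < r.
Proof.
move=> r0 cla.
have nb : nbhs a [set z | `|a - z| < r] by apply/(nbhs_normP a); exists r.
have [|z [[s ts <-] za]] := cla (x @` [set s | t1 < s]) _ _ nb.
  suff : \forall s \near +oo, [set x s | s in [set s | t1 < s]] (x s) by [].
  by near=> s; exists s => //=; near: s; apply: nbhs_pinfty_gt; rewrite num_real.
by exists s => //; rewrite distrC.
Unshelve. all: by end_near. Qed.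

Lemma bounded_near a : {for a, continuous F} ->
  exists2 r : R, 0 < r & forall z, `|z - a| < r -> `|F z| <= `|F a| + 1.
Proof.
move=> /(continuous_at_ball ltr01)[r r0 Fr]; exists r => // z /ltW/Fr zr.
by rewrite -(subrK (F a) (F z)) (le_trans (ler_normD _ _))// addrC lerD2l.
Qed.

(* Each visit to a small ball around a lasts a fixed time, during which the
   nonnegative H drops by a fixed amount if W a > 0. *)
Lemma cluster_dissipation a (W : 'cV[R]_n -> R) (H dH : R -> R) :
  {for a, continuous F} -> {for a, continuous W} ->
  (forall t, t0 < t -> is_derive t 1 H (dH t)) ->
  (forall t, t0 < t -> dH t <= 0) ->
  (forall t, t0 < t -> dH t <= - W (x t)) ->
  (forall t, t0 < t -> 0 <= H t) ->
  cluster (x @ +oo) a -> W a <= 0.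
Proof.
move=> cF cW HE dH0 dHW H0 cla; rewrite leNgt; apply/negP => Wa.
have [r1 r10 FB] := bounded_near cF.
have [r2 r20 Wr] : exists2 r : R, 0 < r & forall z, `|z - a| < r -> W a / 2 <= W z.
  have W2 : 0 < W a / 2 by rewrite divr_gt0.
  move/cvgrPdist_lt : cW => /(_ _ W2)/(nbhs_normP a)[r /= r0 rW].
  exists r => // z zr; have := rW z; rewrite /= distrC => /(_ zr).
  by rewrite ltr_norml; lra.
pose r := Num.min r1 r2; have r0 : 0 < r by rewrite lt_min r10.
pose B := `|F a| + 1; have B0 : 0 < B by rewrite ltr_wpDl.
pose tau := r / 2 / B; have tau0 : 0 < tau by rewrite !divr_gt0.
have Bt : B * tau <= r / 2 by rewrite /tau mulrCA divff ?mulr1// gt_eqF.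
have mvt s t : t0 < s -> s < t -> exists2 c, s < c < t & H t - H s = dH c * (t - s).
  move=> t0s st.
  have [u||c cst ->] := @MVT R H dH s t st.
  - by rewrite in_itv/= => /andP[su _]; apply: HE; exact: lt_trans su.
  - apply: continuous_in_subspaceT => u; rewrite inE/= in_itv/= => /andP[su _].
    by apply: (derive_continuous (HE _ _)); exact: lt_le_trans su.
  by exists c => //; move: cst; rewrite in_itv.
have Hdec s t : t0 < s -> s <= t -> H t <= H s.
  move=> t0s; rewrite le_eqVlt => /predU1P[->//|st].
  have [c /andP[sc ct] E] := mvt _ _ t0s st.
  rewrite -subr_le0 E mulr_le0_ge0//; first by apply: dH0; exact: lt_trans sc.
  by rewrite subr_ge0 ltW.
pose A := H @` [set t | t0 < t].
have infA : has_inf A.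
  split; first by exists (H (t0 + 1)), (t0 + 1) => //=; rewrite ltrDl.
  by exists 0 => _ [t tt <-]; exact: H0.
(* This is the loss of [H] during one visit. After a time where [H] is this close to its infimum,
   one more visit would push [H] below the infimum. *)
have ct0 : 0 < W a / 2 * tau by rewrite mulr_gt0// divr_gt0.
have [_ [t1 t0t1 <-] Ht1] := inf_adherent ct0 infA.
have r20' : 0 < r / 2 by rewrite divr_gt0.
have [s t1s xs] := cluster_frequently t1 r20' cla.
have t0s : t0 < s by exact: lt_trans t1s.
have stay : forall t, s <= t <= s + tau -> `|x t - a| < r.
  apply: (solution_stays t0s (ltW B0) r0 Bt _ xs) => z zr; apply: FB.
  by rewrite (lt_le_trans zr)// ge_min lexx.
have st : s < s + tau by rewrite ltrDl.
have [c /andP[sc cs] E] := mvt _ _ t0s st.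
have dHc : dH c <= - (W a / 2).
  rewrite (le_trans (dHW c _)) ?(lt_trans t0s)// lerN2; apply: Wr.
  by rewrite (lt_le_trans (stay c _)) ?(ltW sc) ?(ltW cs)// ge_min lexx orbT.
have H1 : inf A <= H (s + tau).
  by apply: ge_inf; [exact: infA.2|exists (s + tau) => //=; exact: lt_trans st].
have H2 : H s <= H t1 by apply: Hdec => //; exact: ltW.
have H3 : dH c * (s + tau - s) <= - (W a / 2) * tau.
  by rewrite addrAC subrr add0r ler_wpM2r// ltW.
lra.
Qed.

(* If the i-th component of F a were nonzero, the i-th coordinate would move by a
   fixed amount after each visit near a, producing a cluster point off {b_i = 0}. *)
Lemma cluster_invariant a i (rho : R) : 0 < rho -> {for a, continuous F} ->
  (forall b, `|b - a| < rho -> cluster (x @ +oo) b -> b i 0 = 0) ->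
  cluster (x @ +oo) a -> F a i 0 = 0.
Proof.
move=> rho0 cF inv cla; apply/eqP/negPn/negP => d0.
have dn0 : 0 < `|F a i 0| by rewrite normr_gt0.
have [r1 r10 FB] := bounded_near cF.
have d20 : 0 < `|F a i 0| / 2 by rewrite divr_gt0.
have [r2 r20 Fd] := continuous_at_ball d20 cF.
(* Half of [rho], so that a cluster point in the closed ball of radius [r] still satisfies the
   strict inequality of [inv]. *)
pose r := Num.min (rho / 2) (Num.min r1 r2).
have r0 : 0 < r by rewrite !lt_min r10 r20 divr_gt0.
have rrho : r <= rho / 2 by rewrite ge_min lexx.
have rr1 : r <= r1 by rewrite !ge_min lexx orbT.
have rr2 : r <= r2 by rewrite !ge_min lexx !orbT.
pose B := `|F a| + 1; have B0 : 0 < B by rewrite ltr_wpDl.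
pose tau := r / 2 / B; have tau0 : 0 < tau by rewrite !divr_gt0.
have Bt : B * tau <= r / 2 by rewrite /tau mulrCA divff ?mulr1// gt_eqF.
(* During [tau] the coordinate moves by at least half of [|F a i 0| * tau], that is [2 * m];
   starting below [m] in absolute value, it ends above [m]. *)
pose m := `|F a i 0| * tau / 4; have m0 : 0 < m by rewrite divr_gt0// mulr_gt0.
have cK : compact [set z : 'cV[R]_n | `|z - a| <= r /\ m <= `|z i 0| ].
  exact: closed_ball_coord_ge_compact.
have [|b [br bm] clb] := frequently_cluster cK; last first.
  have bi := inv b _ clb.
  move: bm; rewrite bi; last by rewrite (le_lt_trans br)//; lra.
  by rewrite normr0 leNgt m0.
move=> t.
have ai : a i 0 = 0 by apply: inv cla; rewrite subrr normr0.
have e0 : 0 < Num.min (r / 2) m by rewrite lt_min m0 divr_gt0.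
have [s ts] := cluster_frequently (Num.max t t0) e0 cla.
move: ts; rewrite lt_min gt_max => /andP[ts t0s] /andP[xs xm].
have stay : forall t, s <= t <= s + tau -> `|x t - a| < r.
  apply: (solution_stays t0s (ltW B0) r0 Bt _ xs) => z zr; apply: FB.
  exact: lt_le_trans zr rr1.
exists (s + tau); first by rewrite (lt_trans ts)// ltrDl.
split; first by rewrite ltW// stay// lexx andbT lerDl ltW.
have : `|x (s + tau) - x s - (s + tau - s) *: F a| <= `|F a i 0| / 2 * (s + tau - s).
  apply: (mean_value_ineq (df := F \o x)) => //.
  - by rewrite lerDl ltW.
  - apply: continuous_in_subspaceT => u; rewrite inE/= in_itv/= => /andP[su _].
    by apply: xc; exact: lt_le_trans su.
  - by move=> u /andP[su _]; apply: dx; exact: lt_trans su.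
  - move=> u /andP[su us]; apply: Fd; rewrite ltW// (lt_le_trans _ rr2)//.
    by apply: stay; rewrite !ltW.
have -> : s + tau - s = tau by ring.
move=> /(le_trans (mx_norm_coord _ i 0)).
have : `|x s i 0| < m.
  by apply: le_lt_trans xm; have := mx_norm_coord (x s - a) i 0; rewrite !mxE ai subr0.
rewrite !mxE /m.
set p := x (s + tau) i 0; set q := x s i 0; set d := F a i 0 => qm pm.
have : `|d| * tau <= `|p| + `|q| + `|p - q - tau * d|.
  rewrite -{1}(ger0_norm (ltW tau0)) -normrM.
  have -> : d * tau = p - q - (p - q - tau * d) by ring.
  by rewrite (le_trans (ler_normB _ _))// lerD2r ler_normB.
lra.
Qed.

End Invariance.


(** * The coordinates w *)

Section LinearAlgebra.
Context {F : fieldType}.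

Lemma unitmx_inj n (A : 'M[F]_n) :
  (forall v : 'cV[F]_n, A *m v = 0 -> v = 0) -> A \in unitmx.
Proof.
move=> h; rewrite -unitmx_tr -row_free_unit -kermx_eq0; apply/eqP/row_matrixP => i.
have := mulmx_ker A^T => /(congr1 (row i)); rewrite row_mul !row0 => Ki.
apply: trmx_inj; rewrite trmx0; apply: h.
by apply: trmx_inj; rewrite trmx_mul trmxK trmx0.
Qed.

(** The image of [A] lies in the kernel of [K], and the rank condition leaves no room for a larger
    kernel. Transposes appear because [kermx] and [submx] speak of row spaces. *)
Lemma im_of_ker p n q (K : 'M[F]_(p, n)) (A : 'M[F]_(n, q)) (v : 'cV[F]_n) :
  K *m A = 0 -> (n <= \rank K + \rank A)%N -> K *m v = 0 ->
  exists u, v = A *m u.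
Proof.
move=> KA rk Kv.
have sA : (A^T <= kermx K^T)%MS by apply/sub_kermxP; rewrite -trmx_mul KA trmx0.
have sv : (v^T <= kermx K^T)%MS by apply/sub_kermxP; rewrite -trmx_mul Kv trmx0.
have sK : (kermx K^T <= A^T)%MS.
  rewrite -(geq_leqif (mxrank_leqif_sup sA)) mxrank_ker !mxrank_tr.
  by rewrite leq_subLR.
have /submxP[u vE] := submx_trans sv sK.
by exists u^T; apply: trmx_inj; rewrite vE trmx_mul trmxK.
Qed.

End LinearAlgebra.

(** * Falling factorials and an invertible Hankel matrix *)

Section Factorial.
Context {R : numFieldType}.

Lemma ffact_horner d k :
  (\prod_(i < d) ('X - (i%:R : R)%:P)).[k%:R] = (k ^_ d)%:R.
Proof.
rewrite horner_prod; have [dk|kd] := leqP d k.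
  rewrite ffact_prod natr_prod; apply: eq_bigr => i _.
  by rewrite hornerXsubC natrB// (leq_trans (ltnW (ltn_ord i))).
rewrite ffact_small//; apply/eqP; rewrite prodf_seq_eq0.
by apply/hasP; exists (Ordinal kd); rewrite ?mem_index_enum//= hornerXsubC subrr.
Qed.

(** The combination is a polynomial of degree less than [n] with the [n] roots s, ..., s + n - 1,
    hence zero. Evaluating it at 0, 1, 2, ... isolates the coefficients one at a time, since the
    falling factorial of order d vanishes at k < d. *)
Lemma ffact_combination_eq0 n (b : 'I_n -> R) s :
  (forall j : 'I_n, \sum_d b d * ((j + s) ^_ d)%:R = 0) -> forall d, b d = 0.
Proof.
move=> h.
pose p := \sum_d b d *: \prod_(i < (d : 'I_n)) ('X - (i%:R : R)%:P).
have pE k : p.[k%:R] = \sum_d b d * (k ^_ d)%:R.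
  by rewrite horner_sum; apply: eq_bigr => d _; rewrite hornerZ ffact_horner.
have p0 : p = 0.
  apply: (@roots_geq_poly_eq0 _ _ [seq (j + s)%:R | j <- iota 0 n]).
  - apply/allP => _ /mapP[j + ->]; rewrite mem_iota add0n => /andP[_ jn].
    by apply/rootP; rewrite pE; exact: (h (Ordinal jn)).
  - rewrite map_inj_uniq ?iota_uniq// => i j /eqP.
    by rewrite eqr_nat eqn_add2r => /eqP.
  - rewrite size_map size_iota; apply: (leq_trans (size_sum _ _ _)).
    apply/bigmax_leqP => d _; apply: (leq_trans (size_scale_leq _ _)).
    by rewrite size_prod_XsubC [index_enum _]unlock -enumT size_enum_ord.
suff H k : forall d : 'I_n, (d < k)%N -> b d = 0 by move=> d; exact: (H d.+1 d).
elim: k => // k IH d; rewrite ltnS leq_eqVlt => /predU1P[dk|]; last exact: IH.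
have := pE k; rewrite p0 horner0 (bigD1 d)//= big1 ?addr0; last first.
  move=> e ed; have [ek|ke] := ltnP e k; first by rewrite IH ?mul0r.
  rewrite ffact_small ?mulr0// ltn_neqAle ke andbT.
  by apply: contra ed => /eqP ke'; rewrite -val_eqE /= -ke' dk.
rewrite dk ffactnn => /esym/eqP; rewrite mulf_eq0 pnatr_eq0.
by rewrite gtn_eqF ?fact_gt0// orbF => /eqP.
Qed.

(* Multiplying row j by (j + n + 1)! turns the entries into falling factorials
   of j + n + 1, i.e. values of polynomials of distinct degrees less than n. *)
Lemma hankel_unit n (s : R) : s != 0 ->
  \matrix_(j < n, c < n) (((c + j).+2)`!%:R^-1 * s ^+ (c + j).+2) \in unitmx.
Proof.
case: n => [|n] s0; first by rewrite unitmxE det_mx00 unitr1.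
apply: unitmx_inj => v Hv.
(* The quotient of (j + n + 2)! by (c + j + 2)! is a falling factorial of order n - c, so column c
   corresponds to degree n - c: hence the reversal. The power s^c is absorbed into the coefficient,
   and s^(j + 2) is divided out of row j. *)
pose b (d : 'I_n.+1) := s ^+ (rev_ord d) * v (rev_ord d) 0.
have b0 : forall d, b d = 0.
  apply: (@ffact_combination_eq0 _ _ n.+2) => j.
  have := congr1 (fun A : 'cV_n.+1 => A j 0) Hv; rewrite !mxE.
  move=> /(congr1 (fun a => a * (s ^+ j.+2)^-1 * ((j + n.+2)`!)%:R)).
  rewrite !mul0r => E0; rewrite -[RHS]E0.
  rewrite (reindex_inj rev_ord_inj)/= !mulr_suml; apply: eq_bigr => d _.
  rewrite !mxE /b rev_ordK.
  have dn := ltn_ord d; have E : (j + n.+2 - (n - d) = (d + j).+2)%N by lia.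
  rewrite -(@ffact_fact (j + n.+2) (n - d)); last lia.
  rewrite /= subSS E natrM -addnS -addnS addnS exprD.
  have f0 : (d + j.+2)`!%:R != 0 :> R by rewrite pnatr_eq0 -lt0n fact_gt0.
  have sj0 : s ^+ j.+2 != 0 by rewrite expf_neq0.
  set g := (_`!)%:R in f0 *; set sj := s ^+ j.+2 in sj0 *.
  by field; rewrite f0 sj0.
apply/colP => c; rewrite mxE; have := b0 (rev_ord c).
by rewrite /b rev_ordK => /eqP; rewrite mulf_eq0 expf_eq0 (negPf s0) andbF => /eqP.
Qed.

End Factorial.


(** * Jacobian matrices and directional derivatives *)

Section Derivatives.
Context {R : realType}.

Lemma jacE a b (f : 'cV[R]_a -> 'cV[R]_b) x v :
  differentiable f x -> jac f x *m v = 'D_v f x.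
Proof.
move=> df; rewrite (deriveZsum _ df); apply/colP => i; rewrite mxE summxE.
by apply: eq_bigr => j _; rewrite !mxE mulrC.
Qed.

Lemma mulmx_colP a b (A B : 'M[R]_(b, a)) :
  (forall v : 'cV[R]_a, A *m v = B *m v) -> A = B.
Proof.
move=> h; apply/matrixP => i j.
have := congr1 (fun C : 'cV[R]_b => C i 0) (h (delta_mx j 0)).
by rewrite -!colE !mxE.
Qed.

Lemma jac_comp a b c (f : 'cV[R]_a -> 'cV[R]_b) (g : 'cV[R]_b -> 'cV[R]_c) x :
  differentiable f x -> differentiable g (f x) ->
  jac (g \o f) x = jac g (f x) *m jac f x.
Proof.
move=> df dg; apply: mulmx_colP => v.
rewrite -mulmxA (jacE _ df) (jacE _ dg) (jacE _ (differentiable_comp df dg)).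
exact: derive_comp_cV.
Qed.

Lemma jac_near_id a (f : 'cV[R]_a -> 'cV[R]_a) x :
  (\forall y \near x, f y = y) -> jac f x = 1%:M.
Proof.
move=> fid; have fid' : {near x, id =1 f} by apply: filterS fid => y ->.
have df : differentiable f x.
  by apply: near_eq_differentiable fid' _; exact: (C1at_diff (C1at_id x)).
apply: mulmx_colP => v; rewrite mul1mx jacE//.
by rewrite -(near_eq_derive _ fid') derive_id.
Qed.

Lemma derive_line (V W : normedModType R) (f : V -> W) x v :
  'D_v f x = 'D_1 (fun h : R => f (h *: v + x)) 0.
Proof.
rewrite /derive; set g := (g in _ = lim (g @ _)).
rewrite (_ : (fun h : R => _) = g)//; apply/funext => h; rewrite /g /=.
by rewrite addr0 scale0r add0r [_%:A]mulr1.
Qed.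

Lemma derive_affine (V W : normedModType R) (f : V -> W) x v d :
  (forall h : R, f (h *: v + x) = f x + h *: d) -> 'D_v f x = d.
Proof.
move=> fE; apply: cvg_lim => //; apply: cvg_near_cst.
near=> h; rewrite /= fE addrAC subrr add0r scalerK//.
by near: h; exact: nbhs_dnbhs_neq.
Unshelve. all: by end_near. Qed.

End Derivatives.

(** * Inverting f_w^-1, and the annihilator in the coordinates w *)

Section FW.
Context {R : realType} {m : nat}.
Implicit Types w z : 'cV[R]_m.+3.

(* The index of w_2. *)
Definition i1 : 'I_m.+3 := @Ordinal m.+3 1 isT.

Lemma inord_rshift (c : 'I_m.+1) : inord c.+2 = rshift 2 c :> 'I_m.+3.
Proof. by apply: val_inj; rewrite /= inordK// ltnS ltnS ltn_ord. Qed.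

Lemma co1E w : co w 1 = w ord0 0.
Proof. by rewrite /co; congr (w _ 0); apply: val_inj; rewrite /= inordK. Qed.

Lemma co2E w : co w 2 = w i1 0.
Proof. by rewrite /co; congr (w _ 0); apply: val_inj; rewrite /= inordK. Qed.

Lemma ord3P (P : 'I_m.+3 -> Prop) :
  P ord0 -> P i1 -> (forall c : 'I_m.+1, P (rshift 2 c)) -> forall j, P j.
Proof.
move=> P0 P1 P2 [[|[|j]] jm].
- by rewrite (_ : Ordinal jm = ord0)//; exact: val_inj.
- by rewrite (_ : Ordinal jm = i1)//; exact: val_inj.
have jm' : (j < m.+1)%N by [].
by rewrite (_ : Ordinal jm = rshift 2 (Ordinal jm'))//; exact: val_inj.
Qed.

Lemma sum3_shift (F : nat -> R) :
  \sum_(3 <= i < m.+4) F i = \sum_(c < m.+1) F c.+3.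
Proof.
rewrite -[3%N]add0n big_addn subSS subSS subSS subn0 big_mkord.
by apply: eq_bigr => c _; rewrite addnS addnS addnS addn0.
Qed.

Lemma fwi_0 w : fwi w ord0 0 = w ord0 0.
Proof. by rewrite mxE /= co1E. Qed.

Lemma fwi_1 w : fwi w i1 0 = w ord0 0 * w i1 0 +
  \sum_(c < m.+1) ((c.+1)`!%:R)^-1 * w ord0 0 ^+ c.+1 * w (rshift 2 c) 0.
Proof.
rewrite mxE /= co1E co2E sum3_shift; congr (_ + _); apply: eq_bigr => c _.
by rewrite /co /= inord_rshift subSS subSS subn0.
Qed.

Lemma fwi_2 w (j : 'I_m.+1) : fwi w (rshift 2 j) 0 =
  \sum_(c < m.+1) ((c + j).+2`!%:R)^-1 * w ord0 0 ^+ (c + j).+2 * w (rshift 2 c) 0.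
Proof.
rewrite mxE /= co1E sum3_shift; apply: eq_bigr => c _.
rewrite /co /= inord_rshift.
by have -> : (c.+3 + j.+3 - 4 = (c + j).+2)%N by lia.
Qed.

Lemma co_rshift z (i : 'I_m.+1) : co z i.+3 = z (rshift 2 i) 0.
Proof. by rewrite /co /= inord_rshift. Qed.

Lemma C1at_fwi w : C1at (@fwi R m) w.
Proof.
have C0 : C1at (fun w : 'cV[R]_m.+3 => w ord0 0) w by exact: C1at_coord.
apply: C1at_mx => j i; rewrite ord1; elim/ord3P: j => [||j].
- by apply: eq_C1at C0 => y; rewrite fwi_0.
- apply: (eq_C1at (fun y => esym (fwi_1 y))); apply: C1atD.
    exact: (C1atM C0 (C1at_coord i1 0 w)).
  apply: C1at_sum => c _; apply: C1atM; last exact: C1at_coord.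
  by apply: C1atM; [exact: C1at_cst|exact: (C1atX _ C0)].
apply: (eq_C1at (fun y => esym (fwi_2 y j))).
apply: C1at_sum => c _; apply: C1atM; last exact: C1at_coord.
by apply: C1atM; [exact: C1at_cst|exact: (C1atX _ C0)].
Qed.

(** For w_1 = s, the matrix sending (w_3, ..., w_n) to (z_3, ..., z_n); with indices from 0 the
    exponent i + j - 4 becomes c + j + 2. *)
Definition hankel (s : R) : 'M[R]_m.+1 :=
  \matrix_(j, c) (((c + j).+2)`!%:R^-1 * s ^+ (c + j).+2).

(** [fw] is a chosen inverse without a formula, so regularity is proved for this explicit one: solve
    the Hankel system for w_3, ..., w_n, then obtain w_2 from z_2 by dividing by z_1. *)
Definition fw_expl z : 'cV[R]_m.+3 :=
  let s := z ord0 0 in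
  let v := invmx (hankel s) *m (dsubmx (z : 'cV[R]_(2 + m.+1))) in
  \col_(j < m.+3) match fintype.split (j : 'I_(2 + m.+1)) with
  | inl i => if (i : nat) == 0%N then s else
       s^-1 * (z i1 0 - \sum_(c < m.+1) ((c.+1)`!%:R)^-1 * s ^+ c.+1 * v c 0)
  | inr c => v c 0
  end.

Lemma fw_expl_0 z : fw_expl z ord0 0 = z ord0 0.
Proof.
rewrite mxE; case: fintype.splitP => [i /= E|c /= E]; first by rewrite -E.
by exfalso; move: E; lia.
Qed.

Lemma fw_expl_2 z c : fw_expl z (rshift 2 c) 0 =
  (invmx (hankel (z ord0 0)) *m (dsubmx (z : 'cV[R]_(2 + m.+1)))) c 0.
Proof.
rewrite mxE; case: fintype.splitP => [i /= E|d /= E].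
  by exfalso; move: E (ltn_ord i); lia.
by congr (_ _ 0); apply: val_inj => /=; lia.
Qed.

Lemma fw_expl_1 z : fw_expl z i1 0 = (z ord0 0)^-1 * (z i1 0 -
  \sum_(c < m.+1) ((c.+1)`!%:R)^-1 * z ord0 0 ^+ c.+1 * fw_expl z (rshift 2 c) 0).
Proof.
under eq_bigr do rewrite fw_expl_2.
rewrite {1}mxE; case: fintype.splitP => [i /= E|c /= E]; first by rewrite -E.
by exfalso; move: E; lia.
Qed.

Lemma fwi_d w : dsubmx (fwi w : 'cV[R]_(2 + m.+1)) =
  hankel (w ord0 0) *m dsubmx (w : 'cV[R]_(2 + m.+1)).
Proof.
apply/colP => j; rewrite mxE fwi_2 mxE; apply: eq_bigr => c _.
by rewrite !mxE.
Qed.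

Lemma fwiK w : w ord0 0 != 0 -> fw_expl (fwi w) = w.
Proof.
move=> w0; have hu := hankel_unit m.+1 w0.
have E2 c : fw_expl (fwi w) (rshift 2 c) 0 = w (rshift 2 c) 0.
  by rewrite fw_expl_2 fwi_0 fwi_d mulKmx// mxE.
apply/colP => j; elim/ord3P: j => [||c //].
- by rewrite fw_expl_0 fwi_0.
rewrite fw_expl_1; under eq_bigr do rewrite E2.
by rewrite fwi_0 fwi_1 addrK mulKf.
Qed.

Lemma fw_explK z : z ord0 0 != 0 -> fwi (fw_expl z) = z.
Proof.
move=> z0; have hu := hankel_unit m.+1 z0.
apply/colP => j; elim/ord3P: j => [||j].
- by rewrite fwi_0 fw_expl_0.
- by rewrite fwi_1 fw_expl_0 fw_expl_1 mulVKf// subrK.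
have := fwi_d (fw_expl z); rewrite fw_expl_0.
have -> : dsubmx (fw_expl z : 'cV[R]_(2 + m.+1)) =
   invmx (hankel (z ord0 0)) *m dsubmx (z : 'cV[R]_(2 + m.+1)).
  by apply/colP => c; rewrite mxE fw_expl_2.
by rewrite mulKVmx// => /colP/(_ j); rewrite !mxE.
Qed.

Lemma fwE z : z ord0 0 != 0 -> fw z = fw_expl z.
Proof.
move=> z0; rewrite -{1}(fw_explK z0) /fw.
have inj : {in [set w : 'cV[R]_m.+3 | co w 1 != 0] &, injective (@fwi R m)}.
  move=> u v; rewrite !inE /= !co1E => u0 v0 uv.
  by rewrite -(fwiK u0) uv fwiK.
by rewrite pinvKV// inE /= co1E fw_expl_0.
Qed.

Lemma near_coord0_neq0 z : z ord0 0 != 0 ->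
  nbhs z (fun y : 'cV[R]_m.+3 => y ord0 0 != 0).
Proof.
exact: (cvgr_neq0 _ (@coord_continuous _ _ _ ord0 0 z)).
Qed.

Lemma C1at_fw z : z ord0 0 != 0 -> C1at (@fw R m) z.
Proof.
move=> z0; apply: (@C1at_near _ _ _ fw_expl).
  by apply: filterS (near_coord0_neq0 z0) => y y0; rewrite fwE.
have C0 : C1at (fun w : 'cV[R]_m.+3 => w ord0 0) z by exact: C1at_coord.
have CH : C1at (fun y : 'cV[R]_m.+3 => invmx (hankel (y ord0 0))) z.
  apply: C1at_invmx; first exact: hankel_unit.
  apply: C1at_mx => i j.
  apply: (@eq_C1at _ _ _ (fun y : 'cV[R]_m.+3 =>
    ((j + i).+2`!%:R)^-1 * y ord0 0 ^+ (j + i).+2)) => [y|].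
    by rewrite mxE.
  by apply: C1atM; [exact: C1at_cst|exact: (C1atX _ C0)].
have Cd : C1at (fun y : 'cV[R]_m.+3 => dsubmx (y : 'cV[R]_(2 + m.+1))) z.
  apply: C1at_mx => i j.
  have C1i : C1at (fun y : 'cV[R]_m.+3 => y (rshift 2 (i : 'I_m.+1)) 0) z.
    exact: C1at_coord.
  by apply: eq_C1at C1i => y; rewrite mxE ord1.
have C2 c : C1at (fun y => fw_expl y (rshift 2 c) 0) z.
  apply: (eq_C1at (fun y => esym (fw_expl_2 y c))).
  exact: (C1at_mxE c 0 (C1at_mulmx CH Cd)).
apply: C1at_mx => j i; rewrite ord1; elim/ord3P: j => [||j]; last exact: C2.
- exact: (eq_C1at (fun y => esym (fw_expl_0 y)) C0).
apply: (eq_C1at (fun y => esym (fw_expl_1 y))).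
apply: C1atM; first exact: (C1atV z0 C0).
apply: C1atD; first exact: C1at_coord.
apply: C1atN; apply: C1at_sum => c _; apply: C1atM; last exact: C2.
by apply: C1atM; [exact: C1at_cst|exact: (C1atX _ C0)].
Qed.

Lemma jac_fwK w : w ord0 0 != 0 -> jac (@fw R m) (fwi w) *m jac (@fwi R m) w = 1%:M.
Proof.
move=> w0; have fw0 : fwi w ord0 0 != 0 by rewrite fwi_0.
rewrite -jac_comp; first last.
- exact: (C1at_diff (C1at_fw fw0)).
- exact: (C1at_diff (C1at_fwi w)).
apply: jac_near_id; apply: filterS (near_coord0_neq0 w0) => y y0.
by rewrite /= fwE ?fwiK ?fwi_0.
Qed.

Lemma chainedE z (v : 'cV[R]_m.+3) (i : 'I_m.+1) : (chained_annihilator z *m v) i 0 =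
  - co z i.+2 * v ord0 0 + v (rshift 2 i) 0.
Proof.
rewrite mxE (bigD1 ord0)//= mxE /=; congr (_ + _).
rewrite (bigD1 (rshift 2 i))//= mxE /= eqxx mul1r big1 ?addr0// => j /andP[j0 ji].
rewrite mxE ifN//; have /negPf-> : (j : nat) != i.+2.
  by apply: contra ji => /eqP E; apply/eqP/val_inj.
by rewrite mul0r.
Qed.

(** w_2 occurs only in z_2, with coefficient w_1, and the second column of the annihilator is
    zero. *)
Lemma chained_fwi_e2 w :
  chained_annihilator (fwi w) *m
    (jac (@fwi R m) w *m (delta_mx i1 0 : 'cV[R]_m.+3)) = 0.
Proof.
rewrite jacE; last exact: (C1at_diff (C1at_fwi w)).
rewrite (@derive_affine _ _ _ _ _ _ (w ord0 0 *: delta_mx i1 0)).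
  apply/colP => i; rewrite chainedE !mxE.
  by rewrite /= !mulr0 addr0.
move=> h; apply/colP => j.
have E0 : (h *: delta_mx i1 0 + w) ord0 0 = w ord0 0.
  by rewrite !mxE /= mulr0 add0r.
have E2 c : (h *: delta_mx i1 0 + w) (rshift 2 c) 0 = w (rshift 2 c) 0.
  by rewrite !mxE /= mulr0 add0r.
rewrite [RHS]mxE [X in _ = _ + X]mxE [X in _ = _ + _ * X]mxE.
elim/ord3P: j => [||j].
- by rewrite !fwi_0 E0 mxE/= !mulr0 addr0.
- rewrite !fwi_1 E0; under eq_bigr do rewrite E2.
  by rewrite !mxE eqxx/=; ring.
rewrite !fwi_2 E0; under eq_bigr do rewrite E2.
by rewrite mxE/= !mulr0 addr0.
Qed.

(** Lowering the exponent and the factorial by one turns the series of z_{j+1} into that of z_j, so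
    the w_1-derivative of z_{j+1} is z_j for j >= 3. For j = 2 it is z_2 - w_1 w_2, which is z_2
    under the hypothesis. *)
Lemma chained_fwi_e1 w : w i1 0 = 0 ->
  chained_annihilator (fwi w) *m
    (jac (@fwi R m) w *m (delta_mx ord0 0 : 'cV[R]_m.+3)) = 0.
Proof.
move=> w1; have df := C1at_diff (C1at_fwi w).
rewrite jacE//; apply/colP => i; rewrite chainedE.
rewrite (derive_mx (diff_derivable (v := delta_mx ord0 0) df)) !mxE.
rewrite (@derive_affine _ _ _ _ _ _ (1 : R)); last first.
  by move=> h; rewrite !fwi_0 !mxE eqxx/= addrC.
set u := fun c : nat => ((c + i).+1`!%:R)^-1 * w ord0 0 ^+ (c + i).+1.
have -> : co (fwi w) i.+2 = \sum_(c < m.+1) u c * w (rshift 2 c) 0.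
  (* Row 0 involves z_2, whose formula has the extra term w_1 w_2; the other rows involve z_3, ...,
     z_{n-1}. *)
  rewrite /u; case: i {u} => [[|i] im]/=.
    rewrite co2E fwi_1 w1 mulr0 add0r; apply: eq_bigr => c _.
    by rewrite addn0.
  have im' : (i < m.+1)%N by exact: ltnW.
  rewrite -[i]/(nat_of_ord (Ordinal im')) co_rshift fwi_2.
  by apply: eq_bigr => c _; rewrite /= addnS.
rewrite derive_line.
have -> : (fun h : R => fwi (h *: delta_mx ord0 0 + w) (rshift 2 i) 0) =
    \sum_(c < m.+1) (fun h : R => w (rshift 2 c) 0 *
       (((c + i).+2`!%:R)^-1 * (h + w ord0 0) ^+ (c + i).+2)).
  apply/funext => h; rewrite fwi_2 fct_sumE; apply: eq_bigr => c _.
  by rewrite !mxE eqxx/= mulr1 mulr0 add0r mulrC.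
have d c : is_derive (0 : R) 1 (fun h : R => w (rshift 2 c) 0 *
    (((c + i).+2`!%:R)^-1 * (h + w ord0 0) ^+ (c + i).+2)) (w (rshift 2 c) 0 * u c).
  rewrite (_ : (fun h : R => _) = (w (rshift 2 c) 0 * ((c + i).+2`!%:R)^-1) \*:
    ((id + cst (w ord0 0)) ^+ (c + i).+2)); last first.
    by apply/funext => h; rewrite !fctE /= mulrA.
  apply: is_derive_eq; rewrite /u !fctE add0r addr0 factS natrM.
  have k0 : (c + i).+2%:R != 0 :> R by rewrite pnatr_eq0.
  have f0 : (c + i).+1`!%:R != 0 :> R by rewrite pnatr_eq0 -lt0n fact_gt0.
  have scE (a b : R) : a *: b = a * b by [].
  rewrite !scE mulr1 -!mulrA; congr (_ * _).
  move: ((c + i).+2%:R : R) ((c + i).+1`!%:R : R) k0 f0 => A B A0 B0.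
  by rewrite /=; field; rewrite A0 B0.
rewrite derive_val mulr1 addrC; apply/eqP; rewrite subr_eq0; apply/eqP.
by apply: eq_bigr => c _; rewrite mulrC.
Qed.

End FW.


(** * The closed-loop vector field *)

Section ContinuousMatrix.
Context {R : realType} {T : topologicalType}.

Lemma continuous_at_mx p q (f : T -> 'M[R]_(p, q)) x :
  (forall i j, {for x, continuous (fun y => f y i j)}) -> {for x, continuous f}.
Proof.
move=> cf; rewrite (_ : f = fun y => \sum_i \sum_j f y i j *: delta_mx i j).
  apply: continuous_at_sum => i; apply: continuous_at_sum => j.
  by apply: continuousZr_tmp; exact: cf.
by apply/funext => y; exact: matrix_sum_delta.
Qed.

Lemma continuous_at_mxE p q (f : T -> 'M[R]_(p, q)) x i j :
  {for x, continuous f} -> {for x, continuous (fun y => f y i j)}.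
Proof.
move=> cf; apply: (@continuous_comp _ _ _ f (fun M : 'M[R]_(p, q) => M i j)).
  exact: cf.
exact: coord_continuous.
Qed.

Lemma continuous_at_mulmx p q r (f : T -> 'M[R]_(p, q)) (g : T -> 'M[R]_(q, r)) x :
  {for x, continuous f} -> {for x, continuous g} ->
  {for x, continuous (fun y => f y *m g y)}.
Proof.
move=> cf cg; apply: continuous_at_mx => i j.
rewrite (_ : (fun y => _) = fun y => \sum_k f y i k * g y k j); last first.
  by apply/funext => y; rewrite mxE.
apply: continuous_at_sum => k.
by apply: continuousM; exact: continuous_at_mxE.
Qed.

Lemma continuous_at_trmx p q (f : T -> 'M[R]_(p, q)) x :
  {for x, continuous f} -> {for x, continuous (fun y => (f y)^T)}.
Proof.
move=> cf; apply: continuous_at_mx => i j.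
rewrite (_ : (fun y => _) = fun y => f y j i); last first.
  by apply/funext => y; rewrite mxE.
exact: continuous_at_mxE.
Qed.

Lemma continuous_at_col_mx p1 p2 q (f : T -> 'M[R]_(p1, q)) (g : T -> 'M[R]_(p2, q)) x :
  {for x, continuous f} -> {for x, continuous g} ->
  {for x, continuous (fun y => col_mx (f y) (g y))}.
Proof.
move=> cf cg; apply: continuous_at_mx => i j.
case: (fintype.splitP i) => k ik.
  rewrite (_ : (fun y => _) = fun y => f y k j); first exact: continuous_at_mxE.
  apply/funext => y; rewrite -(col_mxEu (f y) (g y)).
  by rewrite (_ : i = lshift p2 k)//; exact: val_inj.
rewrite (_ : (fun y => _) = fun y => g y k j); first exact: continuous_at_mxE.
apply/funext => y; rewrite -(col_mxEd (f y) (g y)).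
by rewrite (_ : i = rshift p1 k)//; exact: val_inj.
Qed.

End ContinuousMatrix.

(** * Positive definite quadratic forms *)

Section Forms.
Context {R : realType}.

Lemma posdef_unit n (A : 'M[R]_n) : posdef A -> A \in unitmx.
Proof.
move=> Apos; apply: unitmx_inj => v Av; apply/eqP/negPn/negP => /Apos.
by rewrite -mulmxA Av mulmx0 mxE ltxx.
Qed.

Lemma posdef_ge0 n (A : 'M[R]_n) (v : 'cV[R]_n) : posdef A -> 0 <= (v^T *m A *m v) 0 0.
Proof.
move=> Apos; have [->|/Apos/ltW//] := eqVneq v 0.
by rewrite mulmx0 mxE.
Qed.

Lemma posdef_invmx n (A : 'M[R]_n) : symmetric_mx A -> posdef A -> posdef (invmx A).
Proof.
move=> As Apos v v0; have Au := posdef_unit Apos.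
have v0' : invmx A *m v != 0.
  by apply: contra v0 => /eqP E; rewrite -(mulKVmx Au v) E mulmx0.
have := Apos _ v0'; rewrite trmx_mul trmx_inv As -!mulmxA mulKVmx//.
Qed.

(** Cauchy-Schwarz in the inner product of [A], for the i-th basis vector and [invmx A *m p]. It
    bounds the momentum by the kinetic energy and a diagonal entry of the mass matrix, without
    eigenvalues. *)
Lemma posdef_cauchy_schwarz n (A : 'M[R]_n) (p : 'cV[R]_n) i :
  symmetric_mx A -> posdef A -> p i 0 ^+ 2 <= A i i * (p^T *m invmx A *m p) 0 0.
Proof.
move=> As Apos; have Au := posdef_unit Apos.
have qE (s : R) : 0 <= A i i * s ^+ 2 - 2 * p i 0 * s + (p^T *m invmx A *m p) 0 0.
  have := posdef_ge0 (s *: delta_mx i 0 - invmx A *m p) Apos.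
  congr (_ <= _).
  have -> : (s *: delta_mx i 0 - invmx A *m p)^T =
      s *: (delta_mx 0 i : 'rV[R]_n) - p^T *m invmx A.
    apply/rowP => j; rewrite -[in RHS]As -trmx_inv -trmx_mul !mxE.
    by rewrite [in RHS]andbC.
  rewrite mulmxBl mulmxKV// mulmxBr !mulmxBl -!scalemxAl -!scalemxAr.
  rewrite -!mulmxA mulKVmx// mulmxA -!rowE -!colE.
  by move: (p^T *m (invmx A *m p)) => c; rewrite !mxE; ring.
have Aii : 0 < A i i.
  have := Apos (delta_mx i 0); rewrite trmx_delta -rowE -colE !mxE; apply.
  by apply/eqP => /colP/(_ i); rewrite !mxE !eqxx/= => /eqP; rewrite oner_eq0.
(* The minimiser of the quadratic in [s]. *)
have := qE (p i 0 / A i i).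
set c := (_ 0 0); have A0 : A i i != 0 by rewrite gt_eqF.
have -> : A i i * (p i 0 / A i i) ^+ 2 - 2 * p i 0 * (p i 0 / A i i) + c =
   (A i i * c - p i 0 ^+ 2) / A i i by field.
by rewrite pmulr_lge0 ?invr_gt0// subr_ge0.
Qed.

End Forms.

(** * The reduced mass matrix, and the images of Q_z and Q_w *)

Section Structure.
Context {R : realType} {m : nat}.
Variables (S : @mechanical_system R m) (Z : chained_coordinates S).

Lemma Mq_sym q : symmetric_mx (Mq S q).
Proof. by rewrite /symmetric_mx /Mq !trmx_mul trmxK M0_sym mulmxA. Qed.

Lemma Mq_posdef q : posdef (Mq S q).
Proof.
move=> u u0; rewrite /Mq.
have Qu : Q S q *m u != 0.
  apply: contra u0 => /eqP Qu; have rf : row_free (Q S q)^T.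
    by rewrite /row_free mxrank_tr Q_rank.
  apply/eqP/trmx_inj; apply: (row_free_inj rf).
  by rewrite -trmx_mul Qu trmx0 trmx0 mul0mx.
have := @M0_pos _ _ S q _ Qu; rewrite trmx_mul !mulmxA; exact.
Qed.

Lemma C1at_Mq q : C1at (Mq S) q.
Proof.
apply: C1at_mulmx; last exact/smooth_C1at/Q_smooth.
apply: C1at_mulmx; last exact/smooth_C1at/M0_smooth.
exact/C1at_trmx/smooth_C1at/Q_smooth.
Qed.

Lemma C1at_invMq q : C1at (fun q => invmx (Mq S q)) q.
Proof. by apply: C1at_invmx; [exact/posdef_unit/Mq_posdef|exact: C1at_Mq]. Qed.

Lemma C1at_config w : C1at (fun w => fzi Z (fwi w)) w.
Proof.
apply: (@C1at_comp _ _ _ _ (@fwi R m)); first exact: C1at_fwi.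
exact/smooth_C1at/fzi_smooth.
Qed.

Lemma jac_fz_unit z : jac (fz Z) (fzi Z z) \in unitmx.
Proof.
have dfz q : differentiable (fz Z) q by exact/C1at_diff/smooth_C1at/fz_smooth.
have dfzi q : differentiable (fzi Z) q by exact/C1at_diff/smooth_C1at/fzi_smooth.
have : jac (fz Z) (fzi Z z) *m jac (fzi Z) z = 1%:M.
  rewrite -jac_comp//; apply: jac_near_id; apply: filterE => y.
  exact: fziK.
by move=> E; exact: (mulmx1_unit E).1.
Qed.

Lemma Qz_rank z : \rank (Qz Z z) = 2.
Proof.
rewrite /Qz eqmxMfull; last by rewrite row_full_unit jac_fz_unit.
exact: Q_rank.
Qed.

(** The annihilator has n - 2 independent rows and Q_z has rank 2, so the kernel of the former is
    exactly the image of the latter. *)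
Lemma Qz_im z (v : 'cV[R]_m.+3) :
  chained_annihilator z *m v = 0 -> exists u, v = Qz Z z *m u.
Proof.
apply: im_of_ker; first exact: Qz_annihilator.
rewrite Qz_rank.
suff : row_free (chained_annihilator z).
  by rewrite /row_free => /eqP ->; rewrite addn2.
apply/row_freeP; exists (\matrix_(i < m.+3, j < m.+1) ((i : nat) == j.+2)%:R).
apply/matrixP => i j.
have := chainedE z (\col_(k < m.+3) ((k : nat) == j.+2)%:R) i.
rewrite [in LHS]mxE => E.
rewrite [in LHS]mxE; transitivity (\sum_k chained_annihilator z i k *
   (\col_(k < m.+3) ((k : nat) == j.+2)%:R : 'cV[R]_m.+3) k 0).
  by apply: eq_bigr => k _; rewrite !mxE.
by rewrite E !mxE /= mulr0 add0r.
Qed.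

Lemma Qw_im (w : 'cV[R]_m.+3) (v : 'cV[R]_m.+3) : w ord0 0 != 0 ->
  chained_annihilator (fwi w) *m (jac (@fwi R m) w *m v) = 0 ->
  exists u, v = Qw Z w *m u.
Proof.
move=> w0 /Qz_im[u uE]; exists u.
by rewrite /Qw -mulmxA -uE mulmxA jac_fwK// mul1mx.
Qed.

Lemma Qw_equilibrium (w : 'cV[R]_m.+3) (l : 'rV[R]_m.+3) :
  (forall i, 0 < l 0 i) -> w ord0 0 != 0 ->
  (Qw Z w)^T *m (diag_mx l *m w) != 0.
Proof.
move=> l0 w0; apply/eqP => E.
have orth i : (exists u, (delta_mx i 0 : 'cV[R]_m.+3) = Qw Z w *m u) -> w i 0 = 0.
  move=> [u uE]; have : (delta_mx i 0 : 'cV[R]_m.+3)^T *m (diag_mx l *m w) = 0.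
    by rewrite uE trmx_mul -mulmxA E mulmx0.
  rewrite trmx_delta -rowE mul_diag_mx => /matrixP/(_ 0 0).
  by rewrite !mxE => /eqP; rewrite mulf_eq0 gt_eqF//= => /eqP.
have w1 : w i1 0 = 0 by apply: orth; apply: Qw_im => //; exact: chained_fwi_e2.
have E0 : w ord0 0 = 0 by apply: orth; apply: (Qw_im w0); exact: chained_fwi_e1.
by rewrite E0 eqxx in w0.
Qed.

Lemma continuous_Qw (w : 'cV[R]_m.+3) : w ord0 0 != 0 -> {for w, continuous (Qw Z)}.
Proof.
move=> w0; have cfwi : {for w, continuous (@fwi R m)}.
  exact/C1at_continuous/C1at_fwi.
apply: continuous_at_mulmx; last first.
  apply: (@continuous_comp _ _ _ (@fwi R m) (Qz Z)); first exact: cfwi.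
  by apply: smooth_continuous; exact: Qz_smooth.
apply: (@continuous_comp _ _ _ (@fwi R m) (jac (@fw R m))); first exact: cfwi.
have [|_ cD] := @C1at_fw R m (fwi w); first by rewrite fwi_0.
apply: continuous_at_mx => i j.
rewrite (_ : (fun y => _) = fun y => ('D_(delta_mx j 0) (@fw R m) y) i 0); last first.
  by apply/funext => y; rewrite mxE.
exact/continuous_at_mxE/cD.
Qed.

End Structure.


(** Reads a directional derivative of the energy off its restriction to a line on which it is a
    quadratic polynomial; [invmx] is never differentiated explicitly. *)
Lemma derive_quadratic (R : realType) (V : normedModType R) (f : V -> R) x v (a b c : R) :
  (forall h : R, f (h *: v + x) = a + h * b + h ^+ 2 * c) ->
  'D_v (f : V -> R^o) x = b.
Proof.
move=> fE; rewrite derive_line.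
rewrite (_ : (fun h : R => _) = cst a + (b \*: id) + (c \*: (id ^+ 2))); last first.
  apply/funext => h; rewrite fE !fctE /=.
  have scE (s t : R) : s *: t = s * t by [].
  by rewrite !scE mulrC [c * _]mulrC.
rewrite derive_val expr1 add0r mulr0 scale0r scaler0 addr0.
exact: mulr1.
Qed.

(** * Partial derivatives as derivatives in the stacked variable *)

Section Stacked.
Context {R : realType} {a b : nat}.

Lemma C1at_usubmx (x : 'cV[R]_(a + b)) : C1at (fun y : 'cV[R]_(a + b) => usubmx y) x.
Proof.
apply: C1at_mx => i j; apply: eq_C1at (C1at_coord (lshift b i) j x) => y.
by rewrite mxE.
Qed.

Lemma C1at_dsubmx (x : 'cV[R]_(a + b)) : C1at (fun y : 'cV[R]_(a + b) => dsubmx y) x.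
Proof.
apply: C1at_mx => i j; apply: eq_C1at (C1at_coord (rshift a i) j x) => y.
by rewrite mxE.
Qed.

(** Both sides are the derivative at 0 of the same function of one real variable. Joint continuity
    of a partial derivative then follows from [C1at] in the stacked variable. *)
Lemma derive_fst (W : normedModType R) (f : 'cV[R]_a -> 'cV[R]_b -> W) u v d :
  'D_d (fun u' => f u' v) u =
  'D_(col_mx d 0) (fun y : 'cV[R]_(a + b) => f (usubmx y) (dsubmx y)) (col_mx u v).
Proof.
rewrite derive_line [RHS]derive_line.
apply: (congr1 (fun g : R -> W => 'D_1 g 0)); apply/funext => h.
by rewrite scale_col_mx add_col_mx col_mxKu col_mxKd scaler0 add0r.
Qed.

Lemma derive_snd (W : normedModType R) (f : 'cV[R]_a -> 'cV[R]_b -> W) u v d :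
  'D_d (fun v' => f u v') v =
  'D_(col_mx 0 d) (fun y : 'cV[R]_(a + b) => f (usubmx y) (dsubmx y)) (col_mx u v).
Proof.
rewrite derive_line [RHS]derive_line.
apply: (congr1 (fun g : R -> W => 'D_1 g 0)); apply/funext => h.
by rewrite scale_col_mx add_col_mx col_mxKu col_mxKd scaler0 add0r.
Qed.

Lemma delta_mx_lshift (c : 'I_a) :
  (delta_mx (lshift b c) 0 : 'cV[R]_(a + b)) = col_mx (delta_mx c 0) 0.
Proof.
apply/colP => j; case: (fintype.splitP j) => i ji.
  have -> : j = lshift b i by exact: val_inj.
  by rewrite col_mxEu !mxE eq_lshift.
have -> : j = rshift a i by exact: val_inj.
by rewrite col_mxEd !mxE eq_rlshift.
Qed.

Lemma delta_mx_rshift (c : 'I_b) :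
  (delta_mx (rshift a c) 0 : 'cV[R]_(a + b)) = col_mx 0 (delta_mx c 0).
Proof.
apply/colP => j; case: (fintype.splitP j) => i ji.
  have -> : j = lshift b i by exact: val_inj.
  by rewrite col_mxEu !mxE eq_lrshift.
have -> : j = rshift a i by exact: val_inj.
by rewrite col_mxEd !mxE eq_rshift.
Qed.

Lemma grad_col_mx (h : 'cV[R]_a -> 'cV[R]_b -> R) u v :
  col_mx (grad (fun u' => h u' v) u) (grad (fun v' => h u v') v) =
  grad (fun y : 'cV[R]_(a + b) => h (usubmx y) (dsubmx y)) (col_mx u v).
Proof.
apply/colP => i; rewrite [RHS]mxE; case: (fintype.splitP i) => c ic.
  have -> : i = lshift b c by exact: val_inj.
  by rewrite col_mxEu mxE delta_mx_lshift; exact: (@derive_fst R^o).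
have -> : i = rshift a c by exact: val_inj.
by rewrite col_mxEd mxE delta_mx_rshift; exact: (@derive_snd R^o).
Qed.

Lemma is_derive_comp_grad (h : 'cV[R]_a -> R) (f : R -> 'cV[R]_a) t d :
  differentiable (h : 'cV[R]_a -> R^o) (f t) -> is_derive t 1 f d ->
  is_derive t 1 (h \o f) (((grad h (f t))^T *m d) 0 0).
Proof.
move=> dh [df <-].
have df' : differentiable f t by exact/derivable1_diffP.
have dc : differentiable (h \o f : R -> R^o) t by exact: differentiable_comp.
apply: DeriveDef; first exact/derivable1_diffP.
rewrite (derive_comp_cV _ df' dh) (deriveZsum _ dh) mxE.
by apply: eq_bigr => i _; rewrite !mxE mulrC.
Qed.

End Stacked.

(** * Continuity of the field, energy balance and properness of the energy *)

Section ClosedLoop.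
Context {R : realType} {m : nat}.
Variables (S : @mechanical_system R m) (Z : chained_coordinates S).
Variables (Dhat : 'M[R]_2) (k : R) (l : 'rV[R]_m.+3).

Notation state := 'cV[R]_(m.+3 + 2).
Notation F := (closed_loop_field Z Dhat k l).

Definition energy (x : state) : R := Hd Z l (usubmx x) (dsubmx x).

Lemma C1at_Mw w : C1at (fun w => invmx (Mw Z w)) w.
Proof. exact: (@C1at_comp _ _ _ _ _ _ _ (C1at_config Z w) (C1at_invMq S _)). Qed.

Lemma C1at_energy x : C1at (energy : state -> R^o) x.
Proof.
have Cw := C1at_usubmx x; have Cp := C1at_dsubmx x.
have CM := C1at_comp Cw (C1at_Mw (usubmx x)).
apply: C1atD; (apply: C1atM; first exact: C1at_cst); apply: C1at_mxE.
  exact: (C1at_mulmx (C1at_mulmx (C1at_trmx Cp) CM) Cp).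
exact: (C1at_mulmx (C1at_mulmx (C1at_trmx Cw) (C1at_cst _ _)) Cw).
Qed.

Definition grad_w x := usubmx (grad energy x).
Definition grad_p x := dsubmx (grad energy x).

Lemma continuous_grad_energy x : {for x, continuous (grad energy)}.
Proof.
apply: continuous_at_mx => i j.
rewrite (_ : (fun y => _) = fun y => 'D_(delta_mx i 0) (energy : state -> R^o) y).
  exact: (C1at_energy x).2.
by apply/funext => y; rewrite mxE.
Qed.

Lemma closed_loop_fieldE x : F x =
  col_mx (Qw Z (usubmx x) *m grad_p x)
   (- (Qw Z (usubmx x))^T *m grad_w x +
    (Cw Z (usubmx x) (dsubmx x) - Dd Z Dhat k (usubmx x) (dsubmx x)) *m grad_p x).
Proof.
rewrite /closed_loop_field /state_w /state_p grad_col_mx vsubmxK.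
rewrite -[in LHS](vsubmxK (grad _ x)) mul_block_col.
by rewrite mul0mx add0r.
Qed.

Definition config (y : state) : 'cV[R]_m.+3 := fzi Z (fwi (usubmx y)).

Lemma C1at_config_state y : C1at config y.
Proof. exact: (C1at_comp (C1at_usubmx y) (C1at_config Z (usubmx y))). Qed.

Lemma continuous_at_config x : {for x, continuous config}.
Proof. exact/C1at_continuous/C1at_config_state. Qed.

Lemma continuous_at_Q x : {for x, continuous (fun y : state => Q S (config y))}.
Proof.
apply: (@continuous_comp _ _ _ config (Q S)); first exact: continuous_at_config.
by apply: smooth_continuous; exact: Q_smooth.
Qed.

Lemma C1at_Ptot (x : state) :
  C1at (fun y : state => Pq S (usubmx y) (dsubmx y)) x.
Proof.
have Cu := C1at_usubmx x.
apply: (C1at_mulmx _ (C1at_dsubmx x)).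
apply: C1at_mulmx; last exact: (C1at_comp Cu (C1at_invMq S (usubmx x))).
apply: C1at_mulmx.
  exact: (C1at_comp Cu (smooth_C1at _ (@M0_smooth _ _ S))).
exact: (C1at_comp Cu (smooth_C1at _ (@Q_smooth _ _ S))).
Qed.

Lemma continuous_Cw x : {for x, continuous (fun y : state => Cw Z (usubmx y) (dsubmx y))}.
Proof.
have cQ := @continuous_at_Q x.
(* The Jacobian is taken in q at a p that itself varies with the state, so it is treated as a
   partial derivative of P in the pair (q, p). *)
have cJ : {for x, continuous (fun y : state =>
    jac (fun q => Pq S q (dsubmx y)) (config y))}.
  apply: continuous_at_mx => i j.
  pose f y := 'D_(col_mx (delta_mx j 0) 0)
    (fun y : state => Pq S (usubmx y) (dsubmx y)) y.
  rewrite (_ : (fun y => _) =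
    fun y : state => f (col_mx (config y) (dsubmx y)) i 0); last first.
    by apply/funext => y; rewrite mxE derive_fst.
  apply: continuous_at_mxE.
  apply: (@continuous_comp _ _ _ (fun y : state => col_mx (config y) (dsubmx y)) f).
    apply: continuous_at_col_mx; first exact: continuous_at_config.
    exact/C1at_continuous/C1at_dsubmx.
  exact: (C1at_Ptot (col_mx (config x) (dsubmx x))).2.
apply: (continuous_at_mulmx _ cQ); apply: continuous_at_mulmx.
  exact: continuous_at_trmx cQ.
apply: continuousB; [exact: continuous_at_trmx|exact: cJ].
Qed.

Lemma continuous_Dw x : {for x, continuous (fun y : state => Dw Z (usubmx y) (dsubmx y))}.
Proof.
have cQ := @continuous_at_Q x.
have Cp : C1at (fun y : state => col_mx (config y) (dsubmx y)) x.
  apply: C1at_mx => i j; case: (fintype.splitP i) => c ic.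
    apply: eq_C1at (C1at_mxE c j (C1at_config_state x)) => y.
    by rewrite (_ : i = lshift 2 c) ?col_mxEu//; exact: val_inj.
  apply: eq_C1at (C1at_mxE c j (C1at_dsubmx x)) => y.
  by rewrite (_ : i = rshift _ c) ?col_mxEd//; exact: val_inj.
have cP : {for x, continuous (fun y : state => Pq S (config y) (dsubmx y))}.
  apply: C1at_continuous.
  apply: eq_C1at (C1at_comp Cp (C1at_Ptot _)) => y.
  by rewrite col_mxKu col_mxKd.
apply: (continuous_at_mulmx _ cQ); apply: continuous_at_mulmx.
  exact: continuous_at_trmx cQ.
apply: (@continuous_comp _ _ _
  (fun y : state => (Pq S (config y) (dsubmx y), config y))
  (fun z => D0 S z.1 z.2)).
  exact: (cvg_pair cP (@continuous_at_config x)).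
by apply: smooth_continuous; exact: D0_smooth.
Qed.

Lemma usubmx0 (x : state) : usubmx x ord0 0 = x ord0 0.
Proof. by rewrite mxE; congr (x _ _); exact: val_inj. Qed.

Lemma continuous_field (x : state) : x ord0 0 != 0 -> {for x, continuous F}.
Proof.
move=> x0; have Cu := C1at_continuous (C1at_usubmx x).
have x0' : usubmx x ord0 0 != 0 by rewrite usubmx0.
have cQw : {for x, continuous (fun y : state => Qw Z (usubmx y))}.
  apply: (@continuous_comp _ _ _ (fun y : state => usubmx y) (Qw Z)).
    exact: Cu.
  exact: continuous_Qw.
have cg := @continuous_grad_energy x.
have cgp : {for x, continuous grad_p}.
  apply: (@continuous_comp _ _ _ (grad energy) (fun y : state => dsubmx y)).
    exact: cg.
  exact/C1at_continuous/C1at_dsubmx.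
have cgw : {for x, continuous grad_w}.
  apply: (@continuous_comp _ _ _ (grad energy) (fun y : state => usubmx y)).
    exact: cg.
  exact/C1at_continuous/C1at_usubmx.
rewrite (funext closed_loop_fieldE).
have ck : {for x, continuous (fun y : state => k / co (usubmx y) 1 ^+ 2)}.
  rewrite (_ : (fun y => _) = fun y : state => k * (y ord0 0 * y ord0 0)^-1); last first.
    by apply/funext => y; rewrite co1E usubmx0 expr2.
  apply: (@continuousM _ _ (fun=> k)); first exact: cst_continuous.
  apply: (@continuousV _ _ (fun y : state => y ord0 0 * y ord0 0)).
    by rewrite mulf_neq0.
  apply: (@continuousM _ _ (fun y : state => y ord0 0)); exact: coord_continuous.
have cQwT := continuous_at_trmx cQw.
apply: continuous_at_col_mx; first exact: (continuous_at_mulmx cQw cgp).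
apply: continuousD.
  by apply: (continuous_at_mulmx _ cgw); apply: continuousN; exact: cQwT.
apply: (continuous_at_mulmx _ cgp).
apply: continuousB; first exact: continuous_Cw.
apply: continuousD.
  by apply: continuousD; [exact: continuous_Dw|exact: cst_continuous].
apply: (cvgZ ck).
apply: (continuous_at_mulmx _ cQw).
apply: continuous_at_mulmx; last exact: cst_continuous.
apply: continuous_at_mulmx; last exact: cst_continuous.
exact: cQwT.
Qed.

Lemma Cw_skew w p (v : 'cV[R]_2) : (v^T *m Cw Z w p *m v) 0 0 = 0.
Proof.
rewrite /Cw /Cz /Cq; set J := jac _ _; set A := Q S _.
have -> : v^T *m (A^T *m (J^T - J) *m A) *m v =
    (A *m v)^T *m J^T *m (A *m v) - (A *m v)^T *m J *m (A *m v).
  by rewrite trmx_mul !(mulmxBl, mulmxBr) !mulmxA.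
move: (A *m v) J => u J.
have -> : u^T *m J^T *m u = (u^T *m J *m u)^T by rewrite !trmx_mul trmxK mulmxA.
by rewrite !mxE subrr.
Qed.

(** The two Q_w blocks are opposite transposes, so their contributions cancel, and C_w drops out
    because it is skew. *)
Lemma energy_dissipation x :
  ((grad energy x)^T *m F x) 0 0 =
  - ((grad_p x)^T *m Dd Z Dhat k (usubmx x) (dsubmx x) *m grad_p x) 0 0.
Proof.
rewrite closed_loop_fieldE -[grad energy x](vsubmxK) -/(grad_w x) -/(grad_p x).
have := @Cw_skew (usubmx x) (dsubmx x) (grad_p x).
move: (Cw _ _ _) (Dd _ _ _ _ _) (Qw _ _) (grad_w x) (grad_p x) => C D A a b Cb.
rewrite tr_col_mx mul_row_col mulmxDr mulmxBl mulmxBr mulNmx mulmxN.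
have E : b^T *m (A^T *m a) = (a^T *m (A *m b))^T by rewrite !trmx_mul trmxK mulmxA.
rewrite E [LHS]mxE [X in _ + X]mxE [X in _ + (X + _)]mxE [X in _ + (- X + _)]mxE.
rewrite [X in _ + (_ + X)]mxE [X in _ + (_ + (_ + X))]mxE !mulmxA Cb.
by rewrite addrA subrr !add0r.
Qed.

(** w_1' is the first entry of Q_w applied to [grad_p], so the rank-one part of D_d is exactly a
    multiple of its square. *)
Lemma Dd_form (x : state) :
  ((grad_p x)^T *m Dd Z Dhat k (usubmx x) (dsubmx x) *m grad_p x) 0 0 =
  ((grad_p x)^T *m Dw Z (usubmx x) (dsubmx x) *m grad_p x) 0 0 +
  ((grad_p x)^T *m Dhat *m grad_p x) 0 0 + k / x ord0 0 ^+ 2 * (F x ord0 0) ^+ 2.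
Proof.
have -> : F x ord0 0 = (Qw Z (usubmx x) *m grad_p x) ord0 0.
  have := congr1 (fun M : state => M (lshift 2 ord0) 0) (closed_loop_fieldE x).
  by rewrite col_mxEu => <-; congr (F x _ 0); exact: val_inj.
rewrite /Dd co1E usubmx0.
move: (Dw _ _ _) (Qw _ _) (grad_p x) => D A v.
rewrite !mulmxDr !mulmxDl -scalemxAr -scalemxAl.
rewrite [LHS]mxE [X in X + _]mxE; congr (_ + _); rewrite mxE; congr (_ * _).
have E (e : 'cV[R]_m.+3) : v^T *m (A^T *m e *m e^T *m A) *m v =
    (e^T *m (A *m v))^T *m (e^T *m (A *m v)).
  by rewrite !trmx_mul trmxK !mulmxA.
rewrite E.
by rewrite trmx_delta -rowE mxE big_ord1 !mxE expr2.
Qed.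

Lemma Dw_ge0 w p (v : 'cV[R]_2) : 0 <= (v^T *m Dw Z w p *m v) 0 0.
Proof.
rewrite /Dw /Dz /Dq; set A := Q S _; set q := fzi _ _; set p0 := Pq _ _ _.
have := @D0_ge0 _ _ S p0 q (A *m v); rewrite trmx_mul !mulmxA; exact.
Qed.

(** Scaling p by 1 + h makes the energy quadratic in h, with linear coefficient p^T M^-1 p; a
    vanishing gradient thus forces p = 0. *)
Lemma grad_p_eq0 x : grad_p x = 0 -> dsubmx x = 0.
Proof.
move=> gp; set p := dsubmx x; set w := usubmx x.
have de := C1at_diff (C1at_energy x).
have E0 : 'D_(col_mx 0 p) (energy : state -> R^o) x = 0.
  rewrite (deriveZsum _ de) big_split_ord /= big1 ?add0r; last first.
    by move=> i _; rewrite col_mxEu mxE scale0r.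
  apply: big1 => i _; rewrite col_mxEd.
  have := congr1 (fun v : 'cV[R]_2 => v i 0) gp; rewrite !mxE => ->.
  exact: mulr0.
apply/eqP/negPn/negP => /(posdef_invmx (Mq_sym S _) (Mq_posdef S _)).
move=> /(_ (config x)); apply/negP; rewrite -leNgt.
suff : 'D_(col_mx 0 p) (energy : state -> R^o) x =
    (p^T *m invmx (Mq S (config x)) *m p) 0 0 by rewrite E0 => <-.
apply: (@derive_quadratic _ _ _ _ _ (energy x) _
  (2^-1 * (p^T *m invmx (Mq S (config x)) *m p) 0 0)) => h.
have -> : h *: col_mx 0 p + x = col_mx w ((1 + h) *: p).
  rewrite -[x in LHS]vsubmxK scale_col_mx add_col_mx scaler0 add0r.
  by rewrite scalerDl scale1r addrC.
rewrite /energy col_mxKu col_mxKd -/w -/p /Hd /Mw /Mz -/(config x).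
have -> : ((1 + h) *: p)^T = (1 + h) *: p^T by exact: linearZ.
rewrite -!scalemxAl -!scalemxAr scalerA [X in 2^-1 * X + _]mxE -/w.
move: ((p^T *m _ *m p) 0 0) ((w^T *m _ *m w) 0 0) => c d.
by field.
Qed.

Lemma diag_form (u : 'cV[R]_m.+3) :
  (u^T *m diag_mx l *m u) 0 0 = \sum_i l 0 i * u i 0 ^+ 2.
Proof.
by rewrite -mulmxA mul_diag_mx mxE; apply: eq_bigr => i _; rewrite !mxE; ring.
Qed.

(** At p = 0 the kinetic term vanishes for every w, so the w-dependence of the mass matrix does not
    contribute. *)
Lemma grad_w_p0 x : dsubmx x = 0 -> grad_w x = diag_mx l *m usubmx x.
Proof.
move=> p0; have -> : x = col_mx (usubmx x) 0 by rewrite -p0 vsubmxK.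
rewrite col_mxKu; move: (usubmx x) => w.
apply/colP => i; rewrite mul_diag_mx [LHS]mxE [LHS]mxE [RHS]mxE.
apply: (@derive_quadratic _ _ _ _ _ (energy (col_mx w 0)) _ (2^-1 * l 0 i)) => h.
have -> : h *: delta_mx (lshift 2 i) 0 + col_mx w 0 =
    col_mx (h *: delta_mx i 0 + w) 0 :> state.
  by rewrite delta_mx_lshift scale_col_mx add_col_mx scaler0 add0r.
rewrite /energy !col_mxKu !col_mxKd /Hd !mulmx0 !diag_form.
have -> : (0 : 'M[R]_1) 0 0 = 0 by rewrite mxE.
rewrite mulr0 !add0r.
rewrite (bigD1 i)//= [in RHS](bigD1 i)//= !mxE !eqxx/=.
rewrite (eq_bigr (fun j => l 0 j * w j 0 ^+ 2)); last first.
  by move=> j ji; rewrite !mxE (negPf ji) mulr0 add0r.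
by field.
Qed.

Hypothesis l_gt0 : forall i, 0 < l 0 i.

Lemma energy_ge0 x : 0 <= energy x.
Proof.
apply: addr_ge0; apply: mulr_ge0; rewrite ?invr_ge0//.
  exact/posdef_ge0/(posdef_invmx (Mq_sym S _) (Mq_posdef S _)).
by rewrite diag_form sumr_ge0// => i _; rewrite mulr_ge0 ?sqr_ge0// ltW.
Qed.

Lemma ler_norm_sqr (a b : R) : a ^+ 2 <= b -> `|a| <= b + 1.
Proof.
move=> ab; rewrite -[leLHS]mulr1; have := sqr_ge0 (`|a| - 1).
rewrite sqrrB expr1n real_normK ?num_real// mulr1; have := normr_ge0 a; nra.
Qed.

Lemma posdef_diag_ge0 n (A : 'M[R]_n) i : posdef A -> 0 <= A i i.
Proof.
move=> /(posdef_ge0 (delta_mx i 0)); rewrite trmx_delta -rowE -colE !mxE; exact.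
Qed.

(** The quadratic potential bounds w. On the resulting compact ball the diagonal of the mass matrix
    is bounded, and Cauchy-Schwarz then bounds p. *)
Lemma energy_proper e : exists B, forall x, energy x <= e -> `|x| <= B.
Proof.
(* On the sublevel set l_i w_i^2 <= 2 e. The sum gives one bound for all coordinates, and the 1
   comes from [ler_norm_sqr]. *)
pose b := \sum_i 2 * e / l 0 i + 1.
have N0 x : 0 <= ((dsubmx x)^T *m invmx (Mw Z (usubmx x)) *m dsubmx x) 0 0.
  exact/posdef_ge0/(posdef_invmx (Mq_sym S _) (Mq_posdef S _)).
have wb x i : energy x <= e -> `|usubmx x i 0| <= b.
  move=> xe; apply: ler_norm_sqr; have e0 := le_trans (energy_ge0 x) xe.
  rewrite (bigD1 i)//= -[leLHS]addr0 lerD//; last first.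
    by apply: sumr_ge0 => j _; rewrite divr_ge0 ?mulr_ge0// ltW.
  rewrite ler_pdivlMr//; move: xe; rewrite /energy /Hd diag_form (bigD1 i)//=.
  have : 0 <= \sum_(j | j != i) l 0 j * usubmx x j 0 ^+ 2.
    by apply: sumr_ge0 => j _; rewrite mulr_ge0 ?sqr_ge0// ltW.
  have := N0 x; lra.
have [mu Mmu] : exists mu, forall w, `|w| <= b -> forall i, Mw Z w i i <= mu.
  have [[w0 w0b]|nw] := pselect (exists w : 'cV[R]_m.+3, `|w| <= b); last first.
    by exists 0 => w wb'; exfalso; apply: nw; exists w.
  (* The trace is continuous and dominates each diagonal entry, as all of them are nonnegative. *)
  have [|||w1 _ w1max] := @compact_EVT_max _ R (fun w => \tr (Mw Z w))
      [set w : 'cV[R]_m.+3 | `|w - 0| <= b].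
  - by exists w0; rewrite /= subr0.
  - exact: closed_ball_cV_compact.
  - apply: continuous_subspaceT => w; apply: continuous_at_sum => i.
    apply: continuous_at_mxE; apply: C1at_continuous.
    exact: (C1at_comp (C1at_config Z w) (C1at_Mq S _)).
  exists (\tr (Mw Z w1)) => w wb' i.
  apply: le_trans (w1max w _); last by rewrite inE /= subr0.
  rewrite /mxtrace (bigD1 i)//= lerDl sumr_ge0// => j _.
  exact/posdef_diag_ge0/(Mq_posdef S).
exists (b + (mu * (2 * e) + 1)) => x xe; have e0 := le_trans (energy_ge0 x) xe.
have b0 : 0 <= b := le_trans (normr_ge0 _) (wb x ord0 xe).
have wB : `|usubmx x| <= b by apply/mx_norm_leP => // i j; rewrite ord1; exact: wb.
have mu0 : 0 <= mu.
  by apply: le_trans (Mmu _ wB 0); exact/posdef_diag_ge0/(Mq_posdef S).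
have B0 : 0 <= mu * (2 * e) by rewrite !mulr_ge0.
apply/mx_norm_leP => [|i j]; first by rewrite addr_ge0// addr_ge0.
rewrite ord1; case: (fintype.splitP i) => c ic.
  have -> : i = lshift 2 c by exact: val_inj.
  have := wb x c xe; rewrite mxE => /le_trans; apply.
  by rewrite lerDl addr_ge0.
have -> : i = rshift m.+3 c by exact: val_inj.
have := posdef_cauchy_schwarz (dsubmx x) c (Mq_sym S (config x)) (Mq_posdef S _).
rewrite [X in X ^+ 2 <= _]mxE => H.
rewrite (@le_trans _ _ (mu * (2 * e) + 1))//; last by rewrite lerDr.
apply: ler_norm_sqr; apply: (le_trans H); apply: ler_pM.
- exact/posdef_diag_ge0/(Mq_posdef S).
- exact: N0.
- exact: Mmu.
move: xe; rewrite /energy /Hd.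
have : 0 <= ((usubmx x)^T *m diag_mx l *m usubmx x) 0 0.
  by rewrite diag_form sumr_ge0// => c' _; rewrite mulr_ge0 ?sqr_ge0// ltW.
rewrite /Mw /Mz /config; lra.
Qed.

End ClosedLoop.


(** * Convergence *)

Lemma nondecreasing_of_derive (R : realType) (f df : R -> R) (s t : R) : s <= t ->
  (forall u, s <= u <= t -> is_derive u 1 f (df u)) ->
  (forall u, s <= u <= t -> 0 <= df u) -> f s <= f t.
Proof.
move=> st dE d0; rewrite -subr_ge0.
have [u||c] := @MVT_segment R f df s t st.
- by rewrite in_itv/= => /andP[su ut]; apply: dE; rewrite !ltW.
- apply: continuous_in_subspaceT => u; rewrite inE/= in_itv/= => uI.
  exact: derive_continuous (dE _ uI).
by rewrite in_itv/= => cI ->; rewrite mulr_ge0 ?d0// subr_ge0.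
Qed.

(** Every term contains a positive power of w_1. For |w_1| <= 1 all powers beyond the first, like
    the inverse factorials, are at most 1. *)
Lemma fwi_bound (R : realType) m (w : 'cV[R]_m.+3) (B : R) : 0 <= B ->
  (forall i, `|w i 0| <= B) -> `|w ord0 0| <= 1 ->
  `|fwi w| <= `|w ord0 0| * (1 + B + m.+1%:R * B).
Proof.
move=> B0 wB w1; set a := `|w ord0 0|; have a0 : 0 <= a by exact: normr_ge0.
have term k c : `|(k.+1`!%:R)^-1 * w ord0 0 ^+ k.+1 * w c 0| <= a * B.
  rewrite !normrM normrX -/a ler_pM//; first by rewrite mulr_ge0// exprn_ge0.
  rewrite ger0_norm ?invr_ge0// (@le_trans _ _ (1 * a ^+ k.+1))//.
    by rewrite ler_wpM2r ?exprn_ge0// invf_le1 ?ler1n ?ltr0n ?fact_gt0.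
  by rewrite mul1r exprS ler_piMr// exprn_ile1.
have mB : 0 <= m.+1%:R * B by rewrite mulr_ge0.
have sum (F : 'I_m.+1 -> R) : (forall c, `|F c| <= a * B) ->
    `|\sum_c F c| <= a * (m.+1%:R * B).
  move=> FB; rewrite (le_trans (ler_norm_sum _ _ _))//.
  rewrite (le_trans (ler_sum _ (fun c _ => FB c)))// sumr_const card_ord.
  by rewrite -[X in X <= _]mulr_natl mulrCA.
apply/mx_norm_leP => [|j i]; first by rewrite mulr_ge0// !addr_ge0.
rewrite ord1; move: j; apply: ord3P => [||j].
- by rewrite fwi_0 -/a ler_peMr// -addrA lerDl addr_ge0.
- rewrite fwi_1 (le_trans (ler_normD _ _))// mulrDr lerD//.
    by rewrite normrM -/a ler_wpM2l// (le_trans (wB _))// lerDr.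
  by apply: sum => c; exact: term.
rewrite fwi_2 (@le_trans _ _ (a * (m.+1%:R * B)))//.
  by apply: sum => c; exact: term.
by rewrite ler_wpM2l// lerDr addr_ge0.
Qed.

Section Convergence.
Context {R : realType} {m : nat}.
Variables (S : @mechanical_system R m) (Z : chained_coordinates S).
Variables (Dhat : 'M[R]_2) (k : R) (l : 'rV[R]_m.+3).
Hypothesis Dhat_pos : posdef Dhat.
Hypothesis k_gt0 : 0 < k.
Hypothesis l_gt0 : forall i, 0 < l 0 i.

Notation state := 'cV[R]_(m.+3 + 2).
Notation F := (closed_loop_field Z Dhat k l).
Notation H := (energy Z l).
Notation denergy z := (((grad H z)^T *m F z) 0 0).
Notation dissipation z := (((grad_p Z l z)^T *m Dhat *m grad_p Z l z) 0 0).

Lemma is_derive_energy (x : R -> state) (t : R) : is_derive t 1 x (F (x t)) ->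
  is_derive t 1 (H \o x) (denergy (x t)).
Proof. by apply: is_derive_comp_grad; exact: (C1at_diff (C1at_energy Z l (x t))). Qed.

Lemma denergy_le (z : state) :
  denergy z <= - (dissipation z + k / z ord0 0 ^+ 2 * F z ord0 0 ^+ 2).
Proof.
rewrite energy_dissipation Dd_form lerN2 -addrA lerDr; exact: Dw_ge0.
Qed.

Lemma denergy_le0 (z : state) : denergy z <= 0.
Proof.
rewrite (le_trans (denergy_le z))// oppr_le0 addr_ge0 ?posdef_ge0//.
by rewrite mulr_ge0 ?sqr_ge0// divr_ge0 ?sqr_ge0// ltW.
Qed.

Lemma denergy_dissipation (z : state) : denergy z <= - dissipation z.
Proof.
rewrite (le_trans (denergy_le z))// lerN2 lerDl.
by rewrite mulr_ge0 ?sqr_ge0// divr_ge0 ?sqr_ge0// ltW.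
Qed.

Lemma denergy_w1 (z : state) : z ord0 0 != 0 ->
  k * F z ord0 0 ^+ 2 <= - denergy z * z ord0 0 ^+ 2.
Proof.
move=> z0; have z2 : 0 < z ord0 0 ^+ 2 by rewrite exprn_even_gt0.
rewrite -ler_pdivrMr// lerNr (le_trans (denergy_le z))// lerN2 mulrAC.
by rewrite lerDr posdef_ge0.
Qed.

Section Interval.
Variables (x : R -> state) (s t : R).
Hypothesis st : s <= t.
Hypothesis dx : forall u, s <= u <= t -> is_derive u 1 x (F (x u)).
Hypothesis x0 : forall u, s <= u <= t -> x u ord0 0 != 0.

Lemma energy_nonincreasing : H (x t) <= H (x s).
Proof.
rewrite -lerN2; pose df u := - denergy (x u).
apply: (@nondecreasing_of_derive R (- (H \o x)) df _ _ st) => u su; last first.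
  by rewrite /df oppr_ge0 denergy_le0.
by apply: is_deriveN; apply: is_derive_energy; exact: dx.
Qed.

(* The derivative of w_1^2 exp(t - Hd / k) is at least exp(t - Hd / k) (w_1 + w_1')^2. *)
Lemma w1_lower_bound :
  x s ord0 0 ^+ 2 * expR (s - H (x s) / k) <= x t ord0 0 ^+ 2 * expR (t - H (x t) / k).
Proof.
pose g u := u - H (x u) / k.
pose dg u := 1 - denergy (x u) / k.
pose f u := x u ord0 0 ^+ 2 * expR (g u).
pose df u := expR (g u) * (2 * x u ord0 0 * F (x u) ord0 0 + x u ord0 0 ^+ 2 * dg u).
apply: (@nondecreasing_of_derive R f df _ _ st) => u su.
  have dx0 := is_derive_mxE ord0 0 (dx su).
  have dH := is_derive_energy (dx su).
  have dG : is_derive u 1 g (dg u).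
    rewrite (_ : g = id - (k^-1 \*: (H \o x))); last first.
      by apply/funext => v; rewrite /g !fctE /= mulrC.
    by apply: is_derive_eq; rewrite /dg mulrC.
  have dE := is_derive1_comp (is_derive_expR (g u)) dG.
  rewrite (_ : f = ((fun v => x v ord0 0) ^+ 2) * (expR \o g)); last first.
    by apply/funext => v; rewrite /f !fctE.
  apply: is_derive_eq; rewrite /df !fctE /= expr1.
  have scE (p q : R) : p *: q = p * q by [].
  by rewrite !scE; ring.
rewrite /df mulr_ge0 ?expR_ge0//.
have := denergy_w1 (x0 su); rewrite /dg; set d := denergy _.
set a := x u ord0 0; set b := F _ _ _ => kb.
have : b ^+ 2 <= - (d / k) * a ^+ 2.
  rewrite -(ler_pM2l k_gt0) (le_trans kb)//.
  have -> : k * (- (d / k) * a ^+ 2) = - d * a ^+ 2 by field; rewrite gt_eqF.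
  by [].
have := sqr_ge0 (a + b); rewrite sqrrD mulrBr mulr1; lra.
Qed.

End Interval.

Lemma bounded_field (K : set state) : compact K ->
  (forall z, K z -> z ord0 0 != 0) -> exists2 B, 0 <= B & forall z, K z -> `|F z| <= B.
Proof.
move=> cK K0.
have : compact (F @` K).
  apply: continuous_compact => //; apply: continuous_in_subspaceT => z.
  by rewrite inE => /K0; exact: continuous_field.
move=> /compact_bounded/ex_strict_bound_gt0[B /= B0 FB].
exists B; first exact: ltW.
by move=> z Kz; rewrite ltW// FB//; exists z.
Qed.

Lemma maximal_solution_global (t0 : R) (T : \bar R) (x : R -> state) :
  is_maximal_solution Z Dhat k l t0 T x -> T = +oo%E.
Proof.
case: T => [T||] [t0T [xc x0 dx] xmax] //; exfalso.
rewrite lte_fin in t0T.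
have x0' t : t0 <= t < T -> x t ord0 0 != 0.
  move=> /andP[t0t tT]; rewrite -usubmx0 -co1E; apply: x0.
  by split => //; rewrite lte_fin.
have dx' t : t0 < t -> t < T -> is_derive t 1 x (F (x t)).
  by move=> t0t tT; apply: dx => //; rewrite lte_fin.
pose s := (t0 + T) / 2; have t0s : t0 < s by rewrite /s; lra.
have sT : s < T by rewrite /s; lra.
have dxI t : t < T -> forall u, s <= u <= t -> is_derive u 1 x (F (x u)).
  by move=> tT u /andP[su ut]; apply: dx'; [exact: lt_le_trans su|exact: le_lt_trans tT].
have x0I t : t < T -> forall u, s <= u <= t -> x u ord0 0 != 0.
  move=> tT u /andP[su ut]; apply: x0'.
  by rewrite (le_trans (ltW t0s) su) (le_lt_trans ut tT).
have [B xB] := energy_proper Z l_gt0 (H (x s)).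
(* The lower bound of [w1_lower_bound] made uniform on [[s, T[], using that the energy is
   nonnegative and t < T. *)
pose q := x s ord0 0 ^+ 2 * expR (s - H (x s) / k) * expR (- T).
have q0 : 0 < q.
  rewrite mulr_gt0 ?expR_gt0// pmulr_lgt0 ?expR_gt0// exprn_even_gt0//=.
  by apply: x0'; rewrite (ltW t0s).
have xq t : s <= t -> t < T -> q <= x t ord0 0 ^+ 2.
  move=> st tT; rewrite /q expRN ler_pdivrMr ?expR_gt0//.
  rewrite (le_trans (w1_lower_bound st (dxI t tT) (x0I t tT)))//.
  rewrite ler_wpM2l ?sqr_ge0// ler_expR lerBlDr (le_trans (ltW tT))// lerDl.
  by rewrite divr_ge0 ?energy_ge0// ltW.
(* Turns the bound on w_1^2 into one on |w_1| without a square root: if |w_1| < 1 then q <= w_1^2 <=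
   |w_1|. *)
pose c := Num.min 1 q.
have c0 : 0 < c by rewrite lt_min ltr01.
have xc' t : s <= t -> t < T -> c <= `|x t ord0 0|.
  move=> st tT; have := xq t st tT; rewrite -real_normK ?num_real// /c.
  set a := `|_|; have a0 : 0 <= a by exact: normr_ge0.
  rewrite ge_min; have [//|a1] := leP 1 a; rewrite /= => /le_trans; apply.
  by rewrite expr2 ler_piMl// ltW.
pose K := [set z : state | `|z - 0| <= B /\ c <= `|z ord0 0|].
have cK : compact K by exact: closed_ball_coord_ge_compact.
have [z [_ zc]|C C0 FC] := bounded_field cK.
  by rewrite -normr_gt0 (lt_le_trans c0).
have xK t : s <= t -> t < T -> K (x t).
  move=> st tT; split; last exact: xc'.
  rewrite subr0; apply: xB.
  exact: (energy_nonincreasing st (dxI t tT)).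
have [u t su ut tT|a xa] := @lipschitz_left_limit _ _ x s T C sT.
  have := @mean_value_ineq R _ x (F \o x) 0 C u t ut C0.
  rewrite scaler0 subr0; apply.
  - apply: continuous_in_subspaceT => v; rewrite inE/= in_itv/= => /andP[uv vt].
    apply: (derive_continuous (dxI _ tT _ _)).
    by rewrite vt (le_trans (ltW su)).
  - by move=> v /andP[uv vt]; apply: (dxI _ tT); rewrite !ltW// (lt_trans su).
  - move=> v /andP[uv vt]; rewrite subr0 /=; apply: FC; apply: xK.
      by rewrite ltW// (lt_trans su).
    exact: lt_trans tT.
have ac : c <= `|a ord0 0|.
  apply/ler_addgt0Pr => e e0.
  (* Late enough that [C * (T - t)] is at most [e], and still after [s]; this carries the bound [c]
     over to the limit [a]. *)
  pose t := Num.max ((s + T) / 2) (T - e / (C + 1)).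
  have C1 : 0 < C + 1 by rewrite ltr_wpDl.
  have eC : 0 < e / (C + 1) by rewrite divr_gt0.
  have st : s < t by rewrite lt_max; apply/orP; left; lra.
  have tT : t < T by rewrite gt_max; apply/andP; split; lra.
  have te : C * (T - t) <= e.
    have : T - t <= e / (C + 1) by rewrite lerBlDr -lerBlDl le_max lexx orbT.
    rewrite ler_pdivlMr// => h; apply: le_trans h; rewrite mulrC.
    by rewrite ler_wpM2l ?subr_ge0 ?ltW// ltrDl.
  have h : `|x t ord0 0 - a ord0 0| <= e.
    have := mx_norm_coord (x t - a) ord0 0; rewrite !mxE => /le_trans; apply.
    by rewrite (le_trans (xa t _))// st.
  have := xc' t (ltW st) tT.
  have := ler_normD (x t ord0 0 - a ord0 0) (a ord0 0); rewrite subrK; lra.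
have c20 : 0 < c / 2 by rewrite divr_gt0.
have ball0 z : `|z - a| <= c / 2 -> z ord0 0 != 0.
  move=> za; rewrite -normr_gt0.
  have := le_trans (mx_norm_coord (z - a) ord0 0) za; rewrite !mxE => h.
  have := ler_normD (a ord0 0 - z ord0 0) (z ord0 0); rewrite subrK distrC; lra.
have dxs t : s < t -> t < T -> is_derive t 1 x (F (x t)).
  by move=> /(lt_trans t0s); exact: dx'.
have Fc z : `|z - a| <= c / 2 -> {for z, continuous F}.
  by move=> /ball0; exact: continuous_field.
have [tau tau0 [y [yx dy yr]]] := ode_extend sT c20 dxs xa Fc.
have y0 t : t0 <= t -> t < T + tau -> y t ord0 0 != 0.
  move=> t0t tT; have [tltT|Tt] := ltP t T.
    by rewrite yx// x0'// t0t.
  by apply: ball0; exact: yr.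
have dy' t : t0 < t -> t < T + tau -> is_derive t 1 y (F (y t)).
  move=> t0t tT; have [st|ts] := ltP s t; first exact: dy.
  have tT' : t < T by exact: le_lt_trans sT.
  rewrite yx//; apply: (near_eq_is_derive (f := x)); last exact: dx'.
  by near=> u; rewrite yx//; near: u; exact: lt_nbhsl.
apply: (xmax (T + tau)%:E y); first by rewrite lte_fin ltrDl.
  split.
  (* At [t0] no derivative is available; one-sided continuity is inherited from [x], with which [y]
     agrees before [T]. *)
  - apply/subspace_continuousP => t [t0t]; rewrite lte_fin => tT.
    move: t0t; rewrite le_eqVlt => /predU1P[<-|t0t]; last first.
      by apply: cvg_within_filter; exact: (derive_continuous (dy' t t0t tT)).
    move=> W Wy; have Wx : nbhs (x t0) W by rewrite -(yx t0 t0T).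
    have At0 : time_domain t0 T%:E t0 by split => //; rewrite lte_fin.
    have xW : \forall u \near t0, time_domain t0 T%:E u -> W (x u).
      by move/subspace_continuousP : xc => /(_ t0 At0 W Wx).
    have : \forall u \near t0, time_domain t0 (T + tau)%:E u -> W (y u).
      near=> u => -[t0u _].
      have uT : u < T by near: u; exact: lt_nbhsl.
      rewrite yx//; have : time_domain t0 T%:E u by split => //; rewrite lte_fin.
      by near: u; exact: xW.
    exact.
  - move=> t [t0t]; rewrite lte_fin => tT.
    by rewrite co1E usubmx0; exact: y0.
  - by move=> t t0t; rewrite lte_fin => tT; exact: dy'.
by move=> t [_]; rewrite lte_fin => tT; exact: yx.
Unshelve. all: by end_near. Qed.

Lemma w1_cvg0 (t0 : R) (x : R -> state) :
  (forall t, t0 < t -> is_derive t 1 x (F (x t))) ->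
  (forall t, t0 < t -> x t ord0 0 != 0) ->
  x t ord0 0 @[t --> +oo] --> (0 : R).
Proof.
move=> dx x0.
have dxI s t : t0 < s -> forall u, s <= u <= t -> is_derive u 1 x (F (x u)).
  by move=> t0s u /andP[su _]; apply: dx; exact: lt_le_trans su.
pose s := t0 + 1; have t0s : t0 < s by rewrite ltrDl.
have [B xB] := energy_proper Z l_gt0 (H (x s)).
have xb t : s <= t -> `|x t| <= B.
  by move=> st; apply: xB; exact: (energy_nonincreasing st (dxI s t t0s)).
apply/cvgrPdist_lt => e e0; apply: contrapT => nH.
have freq t : exists2 u, t < u &
    [set z : state | `|z - 0| <= B /\ e <= `|z ord0 0|] (x u).
  apply: contrapT => nu; apply: nH; near=> u.
  have tu : t < u by near: u; apply: nbhs_pinfty_gt; rewrite num_real.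
  have su : s < u by near: u; apply: nbhs_pinfty_gt; rewrite num_real.
  rewrite sub0r normrN ltNge; apply/negP => eu; apply: nu; exists u => //.
  by split => //; rewrite subr0 xb// ltW.
have [a [_ ae] cla] :=
  frequently_cluster (@closed_ball_coord_ge_compact R _ (0 : state) B e ord0) freq.
have a0 : a ord0 0 != 0 by rewrite -normr_gt0 (lt_le_trans e0).
(* Proved for every cluster point off w_1 = 0 and not just for [a]: [cluster_invariant] needs p = 0
   at all cluster points near [a]. *)
have gp0 (b : state) : b ord0 0 != 0 -> cluster (x @ +oo) b -> grad_p Z l b = 0.
  move=> b0 clb.
  have cgp : {for b, continuous (grad_p Z l)}.
    apply: (@continuous_comp _ _ _ (grad H) (fun y : state => dsubmx y)).
      exact: continuous_grad_energy.
    exact/C1at_continuous/C1at_dsubmx.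
  have : dissipation b <= 0.
    apply: (@cluster_dissipation _ _ F x t0 dx b (fun z => dissipation z) (H \o x)
      (fun t => denergy (x t))).
    - exact: continuous_field.
    - apply: continuous_at_mxE; apply: (continuous_at_mulmx _ cgp).
      apply: continuous_at_mulmx; last exact: cst_continuous.
      exact: continuous_at_trmx.
    - by move=> t t0t; apply: is_derive_energy; exact: dx.
    - by move=> t t0t; exact: denergy_le0.
    - by move=> t t0t; exact: denergy_dissipation.
    - by move=> t t0t; exact: energy_ge0.
    - exact: clb.
  rewrite leNgt => /negP nd; apply/eqP/negPn/negP => g0; apply: nd.
  exact: Dhat_pos.
(* The radius [e] works because |w_1| >= e at [a], so w_1 cannot vanish at a distance less than
   [e]. *)
have Fp c : F a (rshift m.+3 c) 0 = 0.
  apply: (@cluster_invariant _ _ F x t0 dx a (rshift m.+3 c) e e0 _ _ cla).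
    exact: continuous_field.
  move=> b ba clb; have b0 : b ord0 0 != 0.
    rewrite -normr_gt0.
    have := le_lt_trans (mx_norm_coord (b - a) ord0 0) ba; rewrite !mxE => h.
    have := ler_normD (a ord0 0 - b ord0 0) (b ord0 0); rewrite subrK distrC; lra.
  have /(congr1 (fun v : 'cV[R]_2 => v c 0)) := grad_p_eq0 (gp0 b b0 clb).
  by rewrite !mxE.
have gpa := gp0 a a0 cla.
have a0' : usubmx a ord0 0 != 0 by rewrite usubmx0.
have /negP := Qw_equilibrium Z l_gt0 a0'; apply; apply/eqP.
have := closed_loop_fieldE Z Dhat k l a.
rewrite gpa !mulmx0 addr0 (grad_w_p0 Z l (grad_p_eq0 gpa)) => /(congr1 (@dsubmx _ _ _ _)).
rewrite col_mxKd mulNmx => E; apply/eqP; rewrite -oppr_eq0 -E; apply/eqP.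
by apply/colP => c; rewrite mxE Fp mxE.
Unshelve. all: by end_near. Qed.

Lemma fwi_cvg0 (t0 : R) (x : R -> state) :
  (forall t, t0 < t -> is_derive t 1 x (F (x t))) ->
  x t ord0 0 @[t --> +oo] --> (0 : R) ->
  fwi (usubmx (x t)) @[t --> +oo] --> (0 : 'cV[R]_m.+3).
Proof.
move=> dx x0.
pose s := t0 + 1; have t0s : t0 < s by rewrite ltrDl.
have [B0 xB] := energy_proper Z l_gt0 (H (x s)).
pose B := `|B0|.
have xb t i : s <= t -> `|usubmx (x t) i 0| <= B.
  move=> st; rewrite mxE (le_trans (mx_norm_coord _ _ _))// (le_trans _ (ler_norm _))//.
  apply: xB; apply: (energy_nonincreasing st) => u /andP[su _].
  by apply: dx; exact: lt_le_trans su.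
pose c := 1 + B + m.+1%:R * B; have c0 : 0 < c.
  have Bge0 : 0 <= B by exact: normr_ge0.
  by have := mulr_ge0 (ler0n R m.+1) Bge0; rewrite /c; lra.
apply/cvgrPdist_le => e e0.
have small (d : R) : 0 < d -> \forall t \near +oo, `|x t ord0 0| <= d.
  move=> d0; move/cvgrPdist_le : x0 => /(_ d d0).
  by apply: filterS => t; rewrite sub0r normrN.
near=> t.
have st : s <= t.
  by apply: ltW; near: t; apply: nbhs_pinfty_gt; rewrite num_real.
have x1 : `|usubmx (x t) ord0 0| <= 1.
  by rewrite usubmx0; near: t; exact: small.
rewrite sub0r normrN (le_trans (fwi_bound (normr_ge0 B0) (fun i => xb t i st) x1))//.
rewrite usubmx0 -/B -/c -ler_pdivlMr//.
by near: t; apply: small; rewrite divr_gt0.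
Unshelve. all: by end_near. Qed.

End Convergence.

(** Limits as t tends to infinity are meaningful only for a solution that exists for all later
    times, so [T] = +oo is part of the conclusion. *)
Theorem proposition16 (R : realType) (m : nat)
    (Sys : @mechanical_system R m) (Z : chained_coordinates Sys)
    (Dhat : 'M[R]_2) (hDhat : posdef Dhat)
    (k : R) (hk : 0 < k)
    (l : 'rV[R]_m.+3) (hl : forall i, 0 < l 0 i)
    (t0 : R) (T : \bar R) (x : R -> 'cV[R]_(m.+3 + 2))
    (hx : is_maximal_solution Z Dhat k l t0 T x)
    (hx0 : co (state_w (x t0)) 1 != 0) :
  T = +oo%E /\
  co (state_w (x t)) 1 @[t --> +oo] --> (0 : R) /\
  fwi (state_w (x t)) @[t --> +oo] --> (0 : 'cV[R]_m.+3).
Proof.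
have TE := maximal_solution_global hDhat hk hl hx.
case: hx => _ [_ x0 dx] _; rewrite TE in x0 dx.
have dx' t : t0 < t -> is_derive t 1 x (closed_loop_field Z Dhat k l (x t)).
  by move=> t0t; apply: dx => //; exact: ltry.
have x0' t : t0 < t -> x t ord0 0 != 0.
  move=> t0t; rewrite -usubmx0 -co1E; apply: x0.
  by split; [exact: ltW|exact: ltry].
have w0 := w1_cvg0 hDhat hk hl dx' x0'.
split=> //; split; last exact: (fwi_cvg0 hDhat hk hl dx' w0).
rewrite (_ : (fun t => _) = fun t => x t ord0 0)//.
by apply/funext => t; rewrite co1E usubmx0.
Qed.
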